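(* Let $S$ be an $n$-dimensional statistical manifold, let $\alpha\in\mathbb{R}$, and let $\nabla^{(\alpha)}$ be the $\alpha$-connection on $S$. Let $\pi:F(S)\to S$ be the frame bundle of $S$ with canonical 1-form $\theta$, equipped with the connection $H^{(\alpha)}$ having connection form $\widetilde\omega^{(\alpha)}$, $\alpha$-torsion form $\Theta^{(\alpha)}$ and $\alpha$-curvature form $\Omega^{(\alpha)}$. For a vector field $X$ on $S$ let $\widetilde X^{(\alpha)}$ denote its horizontal lift with respect to $H^{(\alpha)}$. Then for all $X,Y,Z\in\mathfrak{X}(S)$, all $p\in S$ and all $u\in\pi^{-1}(p)$, the following identities hold at $p$ (with all quantities on $F(S)$ evaluated at $u$): $$\nabla^{(\alpha)}_XY=u\bigl(\widetilde X^{(\alpha)}(\theta(\widetilde Y^{(\alpha)}))\bigr),$$ $$T^{(\alpha)}(X,Y)=u\bigl(\Theta^{(\alpha)}(\widetilde X^{(\alpha)},\widetilde Y^{(\alpha)})\bigr)=\nabla^{(\alpha)}_XY-\nabla^{(\alpha)}_YX-[X,Y],$$ $$R^{(\alpha)}(X,Y)Z=u\bigl(\Omega^{(\alpha)}(\widetilde X^{(\alpha)},\widetilde Y^{(\alpha)})\,u^{-1}(Z)\bigr)=\nabla^{(\alpha)}_X\nabla^{(\alpha)}_YZ-\nabla^{(\alpha)}_Y\nabla^{(\alpha)}_XZ-\nabla^{(\alpha)}_{[X,Y]}Z.$$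
   Context: **Statistical manifold and $\alpha$-connection.** A statistical manifold is a family $S=\{p(x;\vartheta):\vartheta\in\Theta_0\}$ of probability density functions on a sample space, parametrized by an open set $\Theta_0\subset\mathbb{R}^n$, where $\vartheta$ serves as coordinates on $S$. The family satisfies the usual regularity conditions: $p>0$, smooth dependence on $\vartheta$, $\vartheta\mapsto p(\cdot;\vartheta)$ injective, all expectations below exist and are smooth in $\vartheta$, and the Fisher matrix is positive definite. Put $l=\log p(x;\vartheta)$, and let $E$ be the expectation with respect to $p(x;\vartheta)$. The Riemannian (Fisher) metric is $g_{ij}=E[(\partial_il)(\partial_jl)]$, also written $\langle\cdot,\cdot\rangle$. For $\alpha\in\mathbb{R}$, the $\alpha$-connection $\nabla^{(\alpha)}$ is the affine connection on $S$ given by $$\langle\nabla^{(\alpha)}_AB,C\rangle=E[(A(Bl))(Cl)]+\tfrac{1-\alpha}{2}E[(Al)(Bl)(Cl)],\qquad A,B,C\in\mathfrak{X}(S).$$ It is torsion free. In a chart $(U_\beta,x_\beta^i)$ of $S$ its coefficients $(\Gamma_\beta^{(\alpha)})^k_{ij}$ are defined by $\nabla^{(\alpha)}_{\partial_i}\partial_j=(\Gamma_\beta^{(\alpha)})^k_{ij}\partial_k$ with $\partial_i=\partial/\partial x^i_\beta$ (summation convention). **Frame bundle.** $F(S)$ is the frame bundle of $TS$, a principal $GL(n;\mathbb{R})$-bundle with projection $\pi$ and right action $R_g(u)=ug$. A point $u\in F(S)$ is identified with the linear isomorphism $u:\mathbb{R}^n\to T_{\pi(u)}S$, $\xi\mapsto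 u\xi$. Over $U_\beta$, the local trivialization $\phi_\beta:\pi^{-1}(U_\beta)\to GL(n;\mathbb{R})$ is given by $u\xi=(\phi_\beta(u))^i_j\xi^j\partial_i$. The canonical 1-form $\theta$ on $F(S)$ is the $\mathbb{R}^n$-valued 1-form $\theta(Y_u)=u^{-1}(\pi_*Y_u)$, $Y_u\in T_uF(S)$. **The connection $H^{(\alpha)}$.** On $U_\beta$ define the $gl(n;\mathbb{R})$-valued 1-form $\omega^{(\alpha)}_\beta$ with entries $(\omega^{(\alpha)}_\beta)^k_j=(\Gamma^{(\alpha)}_\beta)^k_{ji}\,dx^i_\beta$. On $\pi^{-1}(U_\beta)$ define $$\widetilde\omega^{(\alpha)}_\beta(u)=Ad(\phi_\beta(u)^{-1})\circ\pi^*\omega^{(\alpha)}_\beta(u)+(\phi_\beta^*\theta_{G})(u),$$ where $\theta_G(X_g)=(L_g)_*^{-1}X_g$ is the left-invariant Maurer–Cartan form of $G=GL(n;\mathbb{R})$. These local forms agree on overlaps and define a global $gl(n;\mathbb{R})$-valued 1-form $\widetilde\omega^{(\alpha)}$ on $F(S)$, which is the connection form of a unique principal connection $H^{(\alpha)}=\ker\widetilde\omega^{(\alpha)}$. Let $h^{(\alpha)}$ be the projection of $TF(S)$ onto $H^{(\alpha)}$ along the vertical bundle $\ker\pi_*$. The horizontal lift $\widetilde X^{(\alpha)}$ of $X\in\mathfrak{X}(S)$ is the unique vector field on $F(S)$ with values in $H^{(\alpha)}$ and $\pi_*\widetilde X^{(\alpha)}=X$. **Torsion and curvature.** $\Theta^{(\alpha)}=d\theta\circ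 h^{(\alpha)}$ and $\Omega^{(\alpha)}=d\widetilde\omega^{(\alpha)}\circ h^{(\alpha)}$, where $(d\eta\circ h)(X,Y)=d\eta(hX,hY)$ and $d\eta(X,Y)=X(\eta(Y))-Y(\eta(X))-\eta([X,Y])$. The tensors $T^{(\alpha)}$ and $R^{(\alpha)}$ on $S$ are defined from the bundle: for $X,Y,Z\in T_pS$ and $u\in\pi^{-1}(p)$, $T^{(\alpha)}(X,Y):=u(\Theta^{(\alpha)}(\widetilde X^{(\alpha)},\widetilde Y^{(\alpha)}))$ and $R^{(\alpha)}(X,Y)Z:=u(\Omega^{(\alpha)}(\widetilde X^{(\alpha)},\widetilde Y^{(\alpha)})u^{-1}(Z))$. In $\widetilde X^{(\alpha)}(\theta(\widetilde Y^{(\alpha)}))$ the vector field $\widetilde X^{(\alpha)}$ differentiates the $\mathbb{R}^n$-valued function $\theta(\widetilde Y^{(\alpha)})$ on $F(S)$. *)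

(* Defs.v *)
From HB Require Import structures.
From mathcomp Require Import all_boot all_order all_algebra.
From mathcomp Require Import all_classical all_reals all_analysis.

Set Implicit Arguments.
Unset Strict Implicit.
Unset Printing Implicit Defensive.

Import Order.TTheory GRing.Theory Num.Theory.
Import numFieldNormedType.Exports.

Local Open Scope classical_set_scope.
Local Open Scope ring_scope.

(** Conventions.  The parametrization of [S] is injective and its parameter is
    a global coordinate system, so a point of [S] is written as its parameter
    [th : 'cV_n] in the open set [dom S], and a tangent vector as the column
    of its components in the basis [d/dth^i].  Functions, vector fields and
    forms are total Rocq functions of which only the values on the relevant
    open set matter.  [[get x | P x]] is used as a definite description: "the
    [x] such that [P x]". *)

Section Calculus.
Context {R : realType}.

(** On a finite-dimensional [V] this is C^oo on the open set [U]: all iterated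
    directional derivatives exist and are Frechet differentiable on [U]. *)
Definition smooth_on {V W : normedModType R} (U : set V) (f : V -> W) : Prop :=
  forall s : seq V, forall x, U x ->
    differentiable (foldr (fun v (g : V -> W) => 'D_v g) f s) x.

(** [X f], the derivative of [f] along the vector field [X]. *)
Definition vf_act {V W : normedModType R} (X : V -> V) (f : V -> W) : V -> W :=
  fun x => 'D_(X x) f x.

Definition lie_bracket {V : normedModType R} (X Y : V -> V) : V -> V :=
  fun x => vf_act X Y x - vf_act Y X x.

(** [eta x v] is the value at the point [x] of the [W]-valued 1-form [eta] on
    the tangent vector [v]. *)
Definition dform {V W : normedModType R} (eta : V -> V -> W) (X Y : V -> V) :
    V -> W :=
  fun x => vf_act X (fun y => eta y (Y y)) x - vf_act Y (fun y => eta y (X y)) x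
           - eta x (lie_bracket X Y x).

Definition coord_vf {n : nat} (i : 'I_n) : 'cV[R]_n -> 'cV[R]_n :=
  fun=> delta_mx i 0.

End Calculus.

Section Likelihood.
Context {R : realType} {d : measure_display} {T : measurableType d}.
Context (mu : {measure set T -> \bar R}) {n : nat} (p : 'cV[R]_n -> T -> R).

Definition loglik (th : 'cV[R]_n) (x : T) : R := ln (p th x).

(** [A f] for a vector field [A] and a family [f] of functions on the sample
    space: differentiation in the parameter. *)
Definition stat_act (A : 'cV[R]_n -> 'cV[R]_n) (f : 'cV[R]_n -> T -> R)
    (th : 'cV[R]_n) (x : T) : R :=
  vf_act A (f ^~ x) th.

Definition expect (th : 'cV[R]_n) (f : T -> R) : R :=
  \int[mu]_x (f x * p th x).

Definition expect_exists (th : 'cV[R]_n) (f : T -> R) : Prop :=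
  mu.-integrable setT (fun x => (f x * p th x)%:E).

Definition score2 A B th x : R := stat_act A loglik th x * stat_act B loglik th x.

Definition hess_score A B C th x : R :=
  stat_act A (stat_act B loglik) th x * stat_act C loglik th x.

Definition score3 A B C th x : R :=
  stat_act A loglik th x * stat_act B loglik th x * stat_act C loglik th x.

Definition fisher (th : 'cV[R]_n) : 'M[R]_n :=
  \matrix_(i, j) expect th (score2 (coord_vf i) (coord_vf j) th).

Definition regular_expectation (Theta0 : set 'cV[R]_n)
    (f : 'cV[R]_n -> T -> R) : Prop :=
  (forall th, Theta0 th -> expect_exists th (f th)) /\
  smooth_on Theta0 (fun th => expect th (f th)).

End Likelihood.

(** Densities are taken with respect to a reference measure [mu] on the sample
    space.  It suffices to ask for the expectations along coordinate fields:
    those along arbitrary smooth fields are linear combinations of them with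
    smooth coefficients. *)
Record stat_manifold {R : realType} {d : measure_display}
    {T : measurableType d} (mu : {measure set T -> \bar R}) (n : nat) :=
  StatManifold {
    dom : set 'cV[R]_n;
    density : 'cV[R]_n -> T -> R;
    dom_open : open dom;
    density_measurable : forall th, dom th -> measurable_fun setT (density th);
    density_gt0 : forall th x, dom th -> 0 < density th x;
    density_mass1 : forall th, dom th -> (\int[mu]_x (density th x)%:E = 1)%E;
    density_smooth : forall x, smooth_on dom (density ^~ x);
    density_inj : forall th th', dom th -> dom th' ->
      density th = density th' -> th = th';
    regular_score2 : forall i j : 'I_n,
      regular_expectation mu density dom
        (score2 density (coord_vf i) (coord_vf j));
    regular_hess_score : forall i j k : 'I_n,
      regular_expectation mu density dom
        (hess_score density (coord_vf i) (coord_vf j) (coord_vf k));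
    regular_score3 : forall i j k : 'I_n,
      regular_expectation mu density dom
        (score3 density (coord_vf i) (coord_vf j) (coord_vf k));
    fisher_posdef : forall th (v : 'cV[R]_n), dom th -> v != 0 ->
      0 < (v^T *m fisher mu density th *m v) 0 0
  }.

(** A chart of the open submanifold [M] of R^n: a diffeomorphism [cmap] of
    the open set [cdom] onto an open set, with inverse [cinv]. *)
Record chart {R : realType} {n : nat} (M : set 'cV[R]_n) := Chart {
  cdom : set 'cV[R]_n;
  cmap : 'cV[R]_n -> 'cV[R]_n;
  cinv : 'cV[R]_n -> 'cV[R]_n;
  cdom_open : open cdom;
  cdom_sub : cdom `<=` M;
  cimg_open : open (cmap @` cdom);
  cmapK : forall q, cdom q -> cinv (cmap q) = q;
  cmap_smooth : smooth_on cdom cmap;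
  cinv_smooth : smooth_on (cmap @` cdom) cinv
}.

Section Charts.
Context {R : realType} {n : nat} {M : set 'cV[R]_n} (b : chart M).

(** The coordinate field d/dx_b^i on [cdom b], in the basis [d/dth^j]. *)
Definition chart_vf (i : 'I_n) : 'cV[R]_n -> 'cV[R]_n :=
  fun q => 'D_(delta_mx i 0) (cinv b) (cmap b q).

Definition chart_frame (q : 'cV[R]_n) : 'M[R]_n :=
  \matrix_(k, i) chart_vf i q k 0.

Definition chart_dx (i : 'I_n) (q v : 'cV[R]_n) : R :=
  ('D_v (cmap b) q) i 0.

End Charts.

(** In the basis [d/dth^i] a frame at [th] is an invertible matrix [a], so
    F(S) is the open subset [dom S x GL(n)] of the vector space below, which is
    also the tangent space at each of its points. *)
Notation frame_space R n := ('cV[R]_n * 'M[R]_n)%type.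

Section FrameBundle.
Context {R : realType} {n : nat}.
Implicit Types (u : frame_space R n) (V : frame_space R n).

Definition frame_bundle (M : set 'cV[R]_n) : set (frame_space R n) :=
  [set u | M u.1 /\ u.2 \in unitmx].

Definition fb_pi u : 'cV[R]_n := u.1.

(** The projection is linear, so its tangent map is the projection itself. *)
Definition fb_dpi V : 'cV[R]_n := V.1.

(** The isomorphism [u : R^n -> T_(pi u) S] and its inverse. *)
Definition frame_map u (xi : 'cV[R]_n) : 'cV[R]_n := u.2 *m xi.
Definition frame_inv u (v : 'cV[R]_n) : 'cV[R]_n := invmx u.2 *m v.

Definition canonical_form u V : 'cV[R]_n := frame_inv u (fb_dpi V).

Definition maurer_cartan (g A : 'M[R]_n) : 'M[R]_n := invmx g *m A.

Definition Ad (g A : 'M[R]_n) : 'M[R]_n := g *m A *m invmx g.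

(** [phi_b(u)], the solution of [u xi = (phi_b(u))^i_j xi^j d/dx_b^i]. *)
Definition trivialization {M : set 'cV[R]_n} (b : chart M) u : 'M[R]_n :=
  invmx (chart_frame b (fb_pi u)) *m u.2.

End FrameBundle.

Section AlphaGeometry.
Context {R : realType} {d : measure_display} {T : measurableType d}.
Context {mu : {measure set T -> \bar R}} {n : nat}.
Context (S : stat_manifold mu n) (alpha : R).

Definition FS : set (frame_space R n) := frame_bundle (dom S).

Definition fisher_metric (th v w : 'cV[R]_n) : R :=
  (v^T *m fisher mu (density S) th *m w) 0 0.

Definition nabla (A B : 'cV[R]_n -> 'cV[R]_n) : 'cV[R]_n -> 'cV[R]_n :=
  fun th => [get w : 'cV[R]_n |
    forall C, smooth_on (dom S) C ->
      fisher_metric th w (C th) =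
        expect mu (density S) th (hess_score (density S) A B C th)
        + (1 - alpha) / 2
          * expect mu (density S) th (score3 (density S) A B C th)].

(** [christoffel b i j q k 0] is the coefficient with lower indices [i], [j]
    and upper index [k], i.e. the [k]-th component of nabla_{d_i} d_j in the
    basis [d/dx_b^k]. *)
Definition christoffel (b : chart (dom S)) (i j : 'I_n) (q : 'cV[R]_n) :
    'cV[R]_n :=
  invmx (chart_frame b q) *m nabla (chart_vf b i) (chart_vf b j) q.

Definition omega_base (b : chart (dom S)) (q v : 'cV[R]_n) : 'M[R]_n :=
  \matrix_(k, j) \sum_(i < n) christoffel b j i q k 0 * chart_dx b i q v.

Definition omega_local (b : chart (dom S)) (u V : frame_space R n) : 'M[R]_n :=
  Ad (invmx (trivialization b u)) (omega_base b (fb_pi u) (fb_dpi V))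
  + maurer_cartan (trivialization b u) ('D_V (trivialization b) u).

(** The global form: the common value of the local ones. *)
Definition omega (u V : frame_space R n) : 'M[R]_n :=
  [get A : 'M[R]_n |
    forall b : chart (dom S), cdom b (fb_pi u) -> A = omega_local b u V].

Definition horizontal (u : frame_space R n) : set (frame_space R n) :=
  [set V | omega u V = 0].

Definition hproj (u V : frame_space R n) : frame_space R n :=
  [get W : frame_space R n | horizontal u W /\ fb_dpi (V - W) = 0].

Definition hlift (X : 'cV[R]_n -> 'cV[R]_n) (u : frame_space R n) :
    frame_space R n :=
  [get W : frame_space R n | horizontal u W /\ fb_dpi W = X (fb_pi u)].

(** [d eta o h] as an operator on vector fields of F(S). *)
Definition dform_h {W : normedModType R}
    (eta : frame_space R n -> frame_space R n -> W)
    (X Y : frame_space R n -> frame_space R n) : frame_space R n -> W :=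
  dform eta (fun u => hproj u (X u)) (fun u => hproj u (Y u)).

Definition torsion_form X Y : frame_space R n -> 'cV[R]_n :=
  dform_h canonical_form X Y.

Definition curvature_form X Y : frame_space R n -> 'M[R]_n :=
  dform_h omega X Y.

(** The tensors at [q], on tangent vectors: the common value over all frames
    [u] at [q] and all extensions of the vectors to vector fields on S. *)
Definition torsion_tensor (q x y : 'cV[R]_n) : 'cV[R]_n :=
  [get t : 'cV[R]_n | forall X Y u,
    smooth_on (dom S) X -> smooth_on (dom S) Y -> X q = x -> Y q = y ->
    FS u -> fb_pi u = q ->
    t = frame_map u (torsion_form (hlift X) (hlift Y) u)].

Definition curvature_tensor (q x y z : 'cV[R]_n) : 'cV[R]_n :=
  [get t : 'cV[R]_n | forall X Y u,
    smooth_on (dom S) X -> smooth_on (dom S) Y -> X q = x -> Y q = y ->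
    FS u -> fb_pi u = q ->
    t = frame_map u (curvature_form (hlift X) (hlift Y) u *m frame_inv u z)].

End AlphaGeometry.

(* Main.v *)
Require Import Defs.
From HB Require Import structures.
From mathcomp Require Import all_boot all_order all_algebra.
From mathcomp Require Import all_classical all_reals all_analysis ring lra.

Set Implicit Arguments.
Unset Strict Implicit.
Unset Printing Implicit Defensive.

Import Order.TTheory GRing.Theory Num.Theory.
Import numFieldNormedType.Exports.
Local Open Scope classical_set_scope.
Local Open Scope ring_scope.

(** In the global coordinates [th], the defining relation of the alpha-connection
    is solved by [nabla_A B = D_A B + C(A) B], where the matrix [C(v)] is linear
    in [v] and, because second derivatives of the log-likelihood commute,
    satisfies [C(v) w = C(w) v].  This symmetry reconciles the index order of
    [omega_base] (direction in the second lower index of the coefficients) with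
    that of [nabla].  In an arbitrary chart with frame [P] the gauge term
    [P d(P^-1)] cancels the derivative of [P] in the Christoffel symbols, so all
    local forms equal [omega (q, a) (v, w) = a^-1 (C(v) a + w)] and the horizontal
    lift of [X] is [(X, - C(X) a)].  The three identities then follow by
    differentiating [a^-1 Y] and [- C(Y) a] along such lifts: the torsion vanishes
    and the curvature form is [- omega] of the bracket of the lifts. *)

(** * Frechet derivatives *)

Section Differentiability.
Context {R : realType} {V W W' : normedModType R}.

(** The first-order expansion of [f] at [x] is also one of [g], since the two agree near [x];
    uniqueness of the differential then identifies ['d g x] with ['d f x]. Closed formulas valid
    only on an open set are differentiated through this lemma. *)
Lemma near_eq_differentiable (f g : V -> W) (x : V) :
  {near x, f =1 g} -> differentiable f x -> differentiable g x.
Proof.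
move=> fg df; have [dfc _] := (diff_locallyP _ _).1 df.
have gx : f x = g x by apply: (nbhs_singleton fg).
have eqg : g \o shift x = cst (g x) + 'd f x +o_ 0 id.
  apply/eqaddoP => e e0.
  have /eqaddoP/(_ e e0) fe := diff_locally df.
  have sfg : \forall h \near (0 : V), f (h + x) = g (h + x).
    by rewrite (near_shift x) /=; near do rewrite /= sub0r subrK.
  near=> h.
  have fgh : f (h + x) = g (h + x) by near: h.
  have : `|((f \o shift x) - (cst (f x) + 'd f x)) h| <= e * `|id h| by near: h.
  by rewrite !fctE /= gx fgh.
apply/diff_locallyP.
by rewrite (diff_unique dfc eqg).
Unshelve. all: by end_near. Qed.

Lemma derive_comp (f : V -> W) (g : W -> W') (x v : V) :
  differentiable f x -> differentiable g (f x) ->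
  'D_v (fun y => g (f y)) x = 'D_('D_v f x) g (f x).
Proof.
move=> df dg; rewrite !deriveE //; last exact: (differentiable_comp df dg).
by rewrite (diff_comp df dg).
Qed.

Lemma differentiable_bigsum (I : finType) (f : I -> V -> W) (x : V) :
  (forall i, differentiable (f i) x) ->
  differentiable (fun y => \sum_i f i y) x.
Proof.
move=> df; have -> : (fun y => \sum_i f i y) = \sum_i f i.
  by apply/funext => y; rewrite fct_sumE.
elim/big_ind : _ => [|g h dg dh|i _]; last exact: df.
  exact: differentiable_cst.
exact: differentiableD.
Qed.

Lemma derive_bigsum (I : finType) (f : I -> V -> W) (x v : V) :
  (forall i, differentiable (f i) x) ->
  'D_v (fun y => \sum_i f i y) x = \sum_i 'D_v (f i) x.
Proof.
move=> df; have -> : (fun y => \sum_i f i y) = \sum_i f i.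
  by apply/funext => y; rewrite fct_sumE.
suff [] : differentiable (\sum_i f i) x /\
   'D_v (\sum_i f i) x = \sum_i 'D_v (f i) x by [].
apply: (big_ind2 (fun g e => differentiable g x /\ 'D_v g x = e)).
- by split; [exact: differentiable_cst|exact: derive_cst].
- move=> g a h b [dg <-] [dh <-]; split; first exact: differentiableD.
  by rewrite deriveD //; exact: diff_derivable.
- by move=> i _; split.
Qed.

Lemma differentiable_mul (f g : V -> R) (x : V) :
  differentiable f x -> differentiable g x ->
  differentiable (fun y => f y * g y) x.
Proof. exact: differentiableM. Qed.

Lemma derive_mul (f g : V -> R) (x v : V) :
  differentiable f x -> differentiable g x ->
  'D_v (fun y => f y * g y) x = 'D_v f x * g x + f x * 'D_v g x.
Proof.
move=> df dg; rewrite [LHS](deriveM (diff_derivable df) (diff_derivable dg)).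
by rewrite addrC /GRing.scale /= [g x * _]mulrC.
Qed.

Lemma differentiable_bigprod (I : finType) (f : I -> V -> R) (x : V) :
  (forall i, differentiable (f i) x) ->
  differentiable (fun y => \prod_i f i y) x.
Proof.
move=> df; elim: (index_enum I) => [|i s IH].
  under eq_fun do rewrite big_nil; exact: differentiable_cst.
under eq_fun do rewrite big_cons; exact: differentiable_mul.
Qed.

Lemma derive_dirD (f : V -> W) (x v w : V) : differentiable f x ->
  'D_(v + w) f x = 'D_v f x + 'D_w f x.
Proof. by move=> df; rewrite !deriveE // linearD. Qed.

Lemma derive_dirZ (f : V -> W) (x v : V) (k : R) : differentiable f x ->
  'D_(k *: v) f x = k *: 'D_v f x.
Proof. by move=> df; rewrite !deriveE // linearZ. Qed.

Lemma derive_dir_sum (I : finType) (f : V -> W) (x : V) (v : I -> V) :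
  differentiable f x -> 'D_(\sum_i v i) f x = \sum_i 'D_(v i) f x.
Proof.
by move=> df; rewrite deriveE // linear_sum; apply: eq_bigr => i _; rewrite deriveE.
Qed.

End Differentiability.

(** * Derivatives of projections, pairs and scalar multiples *)

Section Pairs.
Context {R : realType} {U V W : normedModType R}.

Lemma differentiable_fst (p : (U * V)%type) : differentiable (@fst U V) p.
Proof.
apply: (@linear_differentiable _ (U * V)%type _ (fst : {linear (U * V)%type -> U})).
by move=> q; apply: cvg_fst.
Qed.

Lemma differentiable_snd (p : (U * V)%type) : differentiable (@snd U V) p.
Proof.
apply: (@linear_differentiable _ (U * V)%type _ (snd : {linear (U * V)%type -> V})).
by move=> q; apply: cvg_snd.
Qed.

Lemma derive_fst (p v : (U * V)%type) : 'D_v (@fst U V) p = v.1.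
Proof.
rewrite deriveE; last exact: differentiable_fst.
rewrite (@diff_lin _ (U * V)%type _ (fst : {linear (U * V)%type -> U})) //.
by move=> q; apply: cvg_fst.
Qed.

Lemma derive_snd (p v : (U * V)%type) : 'D_v (@snd U V) p = v.2.
Proof.
rewrite deriveE; last exact: differentiable_snd.
rewrite (@diff_lin _ (U * V)%type _ (snd : {linear (U * V)%type -> V})) //.
by move=> q; apply: cvg_snd.
Qed.

Lemma derive_pair (f : W -> U) (g : W -> V) (x v : W) :
  differentiable f x -> differentiable g x ->
  'D_v (fun y => (f y, g y)) x = ('D_v f x, 'D_v g x).
Proof.
move=> df dg; rewrite !deriveE //; last exact: differentiable_pair.
by rewrite diff_pair.
Qed.

End Pairs.

Section Scale.
Context {R : realType} {V W : normedModType R}.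

(** Scalar multiplication is packed as a continuous bilinear map, whose differential is known, and
    composed with the pair of [f] and [w]. *)
Lemma derive_scale (f : V -> R) (w : V -> W) (x v : V) :
  differentiable f x -> differentiable w x ->
  differentiable (fun y => f y *: w y) x /\
  'D_v (fun y => f y *: w y) x = 'D_v f x *: w x + f x *: 'D_v w x.
Proof.
move=> df dw.
have lins : bilinear_for
    (GRing.Scale.Law.clone _ _ *:%R _) (GRing.Scale.Law.clone _ _ *:%R _)
    (@GRing.scale R W).
  by split=> [u'|u] a y z /=; rewrite ?scalerDl ?scalerDr !scalerA // mulrC.
pose sM := bilinear_isBilinear.Build R R W W _ _ (@GRing.scale R W) lins.
pose s : {bilinear R -> W -> W} := HB.pack (@GRing.scale R W) sM.
have sc : continuous (fun p : (R * W)%type => s p.1 p.2).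
  by move=> p; apply: scale_continuous.
have dp := differentiable_pair df dw.
have ds := differentiable_bilin (f x, w x) sc.
split; first exact: (differentiable_comp dp ds).
rewrite (derive_comp v dp ds) derive_pair // deriveE // diff_bilin //=.
by rewrite addrC.
Qed.

End Scale.

(** * Symmetry of second derivatives *)

Section Schwarz.
Context {R : realType} {V : normedModType R}.

(** Restriction to a line turns a directional derivative into a one-variable one, to which the mean
    value theorem applies. *)
Lemma derive_line (W : normedModType R) (f : V -> W) (v z : V) (c : R) :
  differentiable f (c *: v + z) ->
  is_derive c 1 (fun s : R => f (s *: v + z)) ('D_v f (c *: v + z)).
Proof.
move=> df; pose A (s : R) := s *: v + z.
have dl : is_diff c ( *:%R^~ v) ( *:%R^~ v) by exact: is_diff_scalel.
have dA : differentiable A c.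
  exact: (differentiableD (@ex_diff _ _ _ _ _ _ _ dl) (differentiable_cst z c)).
have DA : 'D_1 A c = v.
  rewrite deriveE // (diffD (@ex_diff _ _ _ _ _ _ _ dl) (differentiable_cst z c)).
  by rewrite fctE (@diff_val _ _ _ _ _ _ _ dl) diff_cst /= scale1r addr0.
split; first exact/diff_derivable/(differentiable_comp dA df).
by rewrite (derive_comp (f := A) 1 dA df) DA.
Qed.

(** The mean value theorem is applied to [phi], the increment of [f] along [h *: w]; the resulting
    difference of values of [g] is then estimated by the first-order expansion of [g] at [x].
    Continuity of the second derivatives does not enter. *)
Lemma second_difference (U : set V) (f : V -> R) (x v w : V) :
  open U -> U x -> (forall y, U y -> differentiable f y) ->
  differentiable ('D_v f) x ->
  forall e, 0 < e -> exists2 d, 0 < d & forall h, 0 < h -> h < d ->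
  `|f (h *: v + (h *: w + x)) - f (h *: v + x) - f (h *: w + x) + f x
     - h ^+ 2 * 'D_w ('D_v f) x| <= e * h ^+ 2.
Proof.
move=> oU Ux df dg e e0; set g := 'D_v f in dg *.
(* The two remainders add up to at most [e / k * (2 * c * |v| + h * |w|)] with [c <= h], hence to at
   most [e * h]; the summand 1 keeps [k] positive. *)
pose k := 2 * `|v| + `|w| + 1.
have k0 : 0 < k by rewrite /k ltr_wpDl // addr_ge0 // mulr_ge0.
have e'0 : 0 < e / k by rewrite divr_gt0.
have /eqaddoP/(_ _ e'0) := diff_locally dg.
move=> /nbhs_ballP[d1 /= d10 Hd1].
have /nbhs_ballP[d2 /= d20 Hd2] : nbhs x U by apply: open_nbhs_nbhs.
pose d := Num.min d1 d2.
have d0 : 0 < d by rewrite /d lt_min d10.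
exists (d / k); first by rewrite divr_gt0.
move=> h h0; rewrite ltr_pdivlMr // => hd.
have small a b : 0 <= a <= h -> 0 <= b <= h -> `|a *: v + b *: w| < d.
  move=> /andP[a0 ah] /andP[b0 bh].
  rewrite (le_lt_trans _ hd) // (le_trans (ler_normD _ _)) // !normrZ !ger0_norm //.
  have := ler_wpM2r (normr_ge0 v) ah; have := ler_wpM2r (normr_ge0 w) bh.
  have := mulr_ge0 (ltW h0) (normr_ge0 v).
  by rewrite /k !mulrDr mulr1 mulrCA; move: (h * `|v|) (h * `|w|) => *; lra.
have inU a b : 0 <= a <= h -> 0 <= b <= h -> U (a *: v + (b *: w + x)).
  move=> ha hb; apply: Hd2; rewrite -ball_normE /= addrA distrC addrK.
  by rewrite (lt_le_trans (small _ _ ha hb)) // /d ge_min lexx orbT.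
have rem a b : 0 <= a <= h -> 0 <= b <= h ->
    `|g (a *: v + (b *: w + x)) - (g x + 'd g x (a *: v + b *: w))| <=
    e / k * `|a *: v + b *: w|.
  move=> ha hb.
  have := Hd1 (a *: v + b *: w); rewrite -ball_normE /= add0r normrN.
  rewrite (lt_le_trans (small _ _ ha hb)); last by rewrite /d ge_min lexx.
  by move=> /(_ isT); rewrite !fctE /= addrA.
have h0h : 0 <= h <= h by rewrite ltW /=.
have h00 : (0 : R) <= 0 <= h by rewrite lexx ltW.
pose phi s := f (s *: v + (h *: w + x)) - f (s *: v + x).
have dphi c : 0 <= c <= h ->
    is_derive c 1 phi (g (c *: v + (h *: w + x)) - g (c *: v + x)).
  move=> hc; apply: is_deriveB; apply: derive_line; apply: df.
    exact: inU.
  by rewrite -(add0r x) -(scale0r w); apply: inU.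
have [c] := MVT_segment (ltW h0)
  (fun c hc => dphi c ltac:(by move: hc; rewrite in_itv /= => /andP[/ltW -> /ltW ->]))
  ltac:(by apply: derivable_within_continuous => c; rewrite in_itv /= => /dphi []).
rewrite in_itv /= subr0 => hc.
rewrite /phi !scale0r !add0r => E.
have -> : f (h *: v + (h *: w + x)) - f (h *: v + x) - f (h *: w + x) + f x =
  (g (c *: v + (h *: w + x)) - g (c *: v + x)) * h.
  by rewrite -E; ring.
have := rem c h hc h0h; have := rem c 0 hc h00; rewrite scale0r !add0r addr0.
rewrite (linearD ('d g x)) /= deriveE // => r2 r1.
(* The terms ['d g x (c *: v)] cancel, so the unknown intermediate point [c] survives only in the
   two remainders. *)
have -> : (g (c *: v + (h *: w + x)) - g (c *: v + x)) * h - h ^+ 2 * 'd g x w =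
   ((g (c *: v + (h *: w + x)) - (g x + ('d g x (c *: v) + 'd g x (h *: w)))) -
   (g (c *: v + x) - (g x + 'd g x (c *: v)))) * h.
  rewrite [in RHS](linearZ _ w) /= /GRing.scale /=; ring.
rewrite normrM (gtr0_norm h0) expr2 [e * (h * h)]mulrA ler_pM2r //.
apply: (le_trans (ler_normB _ _)); apply: (le_trans (lerD r1 r2)).
rewrite -mulrDr -mulrA ler_pM2l // ler_pdivrMl // [k * h]mulrC.
have := ler_normD (c *: v) (h *: w).
rewrite !normrZ (gtr0_norm h0); case/andP: hc => c0 ch; rewrite ger0_norm //.
have := ler_wpM2r (normr_ge0 v) ch.
have := mulr_ge0 (ltW h0) (normr_ge0 v).
rewrite /k !mulrDr mulr1 mulrCA; move: (h * `|v|) (h * `|w|) (c * `|v|) `|_ + _| => *; lra.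
Qed.

(** The second difference is symmetric in [v] and [w], so after multiplication by [h ^+ 2] both
    mixed derivatives lie within [e / 2 * h ^+ 2] of the same number. *)
Lemma derive_swap_real (U : set V) (f : V -> R) (x v w : V) :
  open U -> U x -> (forall y, U y -> differentiable f y) ->
  differentiable ('D_v f) x -> differentiable ('D_w f) x ->
  'D_w ('D_v f) x = 'D_v ('D_w f) x.
Proof.
move=> oU Ux df dv dw; apply/eqP; rewrite -subr_eq0 -normr_le0.
apply/ler_addgt0Pl => e e0; rewrite addr0.
have e20 : 0 < e / 2 by rewrite divr_gt0.
have [d1 d10 H1] := second_difference w oU Ux df dv e20.
have [d2 d20 H2] := second_difference v oU Ux df dw e20.
pose h := Num.min d1 d2 / 2.
have m0 : 0 < Num.min d1 d2 by rewrite lt_min d10.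
have h0 : 0 < h by rewrite divr_gt0.
have hm : h < Num.min d1 d2 by rewrite /h ltr_pdivrMr // mulr_natr mulr2n ltrDl.
move: hm; rewrite lt_min => /andP[/(H1 h h0) {}H1 /(H2 h h0) {}H2].
have h20 : 0 < h ^+ 2 by rewrite exprn_gt0.
rewrite -(ler_pM2r h20) -{1}(gtr0_norm h20) -normrM.
move: H1 H2; rewrite [h *: w + (h *: v + x)]addrCA.
move: ('D_w ('D_v f) x) ('D_v ('D_w f) x) => a b H1 H2.
apply: (@le_trans _ _ (e / 2 * h ^+ 2 + e / 2 * h ^+ 2)); last by rewrite -mulrDl -splitr.
apply: (le_trans _ (lerD H2 H1)); apply: (le_trans _ (ler_normB _ _)).
by rewrite le_eqVlt; apply/orP; left; apply/eqP; congr `|_|; ring.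
Qed.

End Schwarz.

(** * Matrix-valued functions *)

Section Matrices.
Context {R : realType} {V : normedModType R}.

Lemma differentiable_mxP (m n : nat) (M : V -> 'M[R]_(m, n)) (x : V) :
  differentiable M x <-> forall i j, differentiable (fun y => M y i j) x.
Proof.
split=> [dM i j|dM].
  exact: (differentiable_comp dM (differentiable_coord (M x) i j)).
have -> : M = (fun y => \sum_i \sum_j M y i j *: delta_mx i j).
  by apply/funext => y; exact: matrix_sum_delta.
apply: differentiable_bigsum => i; apply: differentiable_bigsum => j.
exact: differentiableZl.
Qed.

Lemma derive_coord (m n : nat) (M : V -> 'M[R]_(m, n)) (x v : V) i j :
  differentiable M x -> ('D_v M x) i j = 'D_v (fun y => M y i j) x.
Proof. by move=> dM; rewrite derive_mx ?mxE //; exact: diff_derivable. Qed.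

Lemma differentiable_mulmx (m n p : nat) (A : V -> 'M[R]_(m, n))
    (B : V -> 'M[R]_(n, p)) (x : V) :
  differentiable A x -> differentiable B x ->
  differentiable (fun y => A y *m B y) x.
Proof.
move=> /differentiable_mxP dA /differentiable_mxP dB.
apply/differentiable_mxP => i j; under eq_fun do rewrite mxE.
by apply: differentiable_bigsum => k; exact: differentiable_mul.
Qed.

Lemma derive_mulmx (m n p : nat) (A : V -> 'M[R]_(m, n))
    (B : V -> 'M[R]_(n, p)) (x v : V) :
  differentiable A x -> differentiable B x ->
  'D_v (fun y => A y *m B y) x = 'D_v A x *m B x + A x *m 'D_v B x.
Proof.
move=> dA dB; have dAij := (differentiable_mxP _ _).1 dA.
have dBij := (differentiable_mxP _ _).1 dB.
apply/matrixP => i j; rewrite derive_coord; last exact: differentiable_mulmx.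
under eq_fun do rewrite mxE.
rewrite derive_bigsum; last by move=> k; exact: differentiable_mul.
rewrite !mxE -big_split; apply: eq_bigr => k _ /=.
by rewrite derive_mul // !derive_coord.
Qed.

Lemma differentiable_det (n : nat) (A : V -> 'M[R]_n) (x : V) :
  differentiable A x -> differentiable (fun y => \det (A y)) x.
Proof.
move=> /differentiable_mxP dA; apply: differentiable_bigsum => s.
by apply: differentiable_mul; [exact: differentiable_cst|exact: differentiable_bigprod].
Qed.

(** The determinant is continuous and being nonzero is an open condition. *)
Lemma near_unitmx (n : nat) (A : V -> 'M[R]_n) (x : V) :
  differentiable A x -> A x \in unitmx -> \forall y \near x, A y \in unitmx.
Proof.
move=> dA; rewrite unitmxE unitfE => Ax.
have := differentiable_continuous (differentiable_det dA).
move=> /(_ [set r | r != 0]) /=; rewrite nbhs_simpl /=.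
have o : nbhs (\det (A x)) [set r : R | r != 0].
  by apply: open_nbhs_nbhs; split => //; exact: open_neq.
by move=> /(_ o); apply: filterS => y; rewrite /= unitmxE unitfE.
Qed.

Lemma differentiable_invmx (n : nat) (A : V -> 'M[R]_n) (x : V) :
  differentiable A x -> A x \in unitmx -> differentiable (fun y => invmx (A y)) x.
Proof.
move=> dA Ax; have dAij := (differentiable_mxP _ _).1 dA.
(* The adjugate formula for [invmx] holds only at invertible matrices (elsewhere [invmx] returns its
   argument), hence only near [x]. *)
apply: (@near_eq_differentiable _ _ _ (fun y => (\det (A y))^-1 *: \adj (A y))).
  by near=> y; rewrite /invmx ifT //; near: y; exact: near_unitmx.
apply/differentiable_mxP => i j; under eq_fun do rewrite !mxE.
apply: differentiable_mul.
  apply: (@differentiableV _ _ (fun y => \det (A y))); first exact: differentiable_det.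
  by move: Ax; rewrite unitmxE unitfE.
apply: differentiable_mul; first exact: differentiable_cst.
apply: differentiable_det; apply/differentiable_mxP => k l.
by under eq_fun do rewrite !mxE.
Unshelve. all: by end_near. Qed.

(** Obtained by differentiating [A y *m invmx (A y) = 1%:M], valid near [x]. *)
Lemma derive_invmx (n : nat) (A : V -> 'M[R]_n) (x v : V) :
  differentiable A x -> A x \in unitmx ->
  'D_v (fun y => invmx (A y)) x = - (invmx (A x) *m 'D_v A x *m invmx (A x)).
Proof.
move=> dA Ax; have dV := differentiable_invmx dA Ax.
have : 'D_v (fun y => A y *m invmx (A y)) x = 0.
  rewrite -[RHS](derive_cst (1%:M : 'M[R]_n) x v); apply: near_eq_derive.
  by near=> y; rewrite mulmxV //; near: y; exact: near_unitmx.
rewrite derive_mulmx // => /eqP; rewrite addrC addr_eq0 => /eqP E.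
by rewrite -[LHS](mulKmx Ax) E mulmxN mulmxA.
Unshelve. all: by end_near. Qed.

End Matrices.

(** * Twice differentiable maps and derivatives along vector fields *)

Section SecondDerivatives.
Context {R : realType} {V : normedModType R}.

(** A two-order form of [smooth_on], which can be checked directly for the log-likelihood without
    iterated chain rules. *)
Definition differentiable2_on {W : normedModType R} (U : set V) (f : V -> W) :=
  (forall x, U x -> differentiable f x) /\
  (forall v x, U x -> differentiable ('D_v f) x).

Lemma smooth_on_differentiable2 {W : normedModType R} (U : set V) (f : V -> W) :
  smooth_on U f -> differentiable2_on U f.
Proof.
by move=> sf; split=> [x|v x]; [exact: (sf [::])|exact: (sf [:: v])].
Qed.

Lemma derive_swap (m n : nat) (U : set V) (f : V -> 'M[R]_(m, n)) (x v w : V) :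
  open U -> U x -> differentiable2_on U f ->
  'D_w ('D_v f) x = 'D_v ('D_w f) x.
Proof.
move=> oU Ux [df d2f]; apply/matrixP => i j.
(* Taking an entry commutes with differentiation only on [U], so the identity is a local one and
   must be transported to second derivatives. *)
have E z : {near x, (fun y => 'D_z f y i j) =1 'D_z (fun y => f y i j)}.
  near=> y; rewrite derive_coord //; apply: df; near: y.
  exact: open_nbhs_nbhs.
have dE z : differentiable ('D_z (fun y => f y i j)) x.
  apply: (near_eq_differentiable (E z)).
  exact: (differentiable_mxP _ _).1 (d2f z x Ux) i j.
have D a b : ('D_a ('D_b f) x) i j = 'D_a ('D_b (fun y => f y i j)) x.
  exact: etrans (derive_coord a i j (d2f b x Ux)) (near_eq_derive a (E b)).
apply: etrans (D w v) (etrans _ (esym (D v w))).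
apply: derive_swap_real Ux _ _ _ => // y Uy.
exact: (differentiable_mxP _ _).1 (df y Uy) i j.
Unshelve. all: by end_near. Qed.

End SecondDerivatives.

Section VectorFields.
Context {R : realType} {n : nat} {W : normedModType R}.

Lemma col_sum_delta (v : 'cV[R]_n) : v = \sum_i v i 0 *: delta_mx i 0.
Proof.
rewrite {1}(matrix_sum_delta v); apply: eq_bigr => i _.
by rewrite big_ord_recl big_ord0 addr0.
Qed.

Lemma derive_dir_coord (f : 'cV[R]_n -> W) (x v : 'cV[R]_n) :
  differentiable f x -> 'D_v f x = \sum_i v i 0 *: 'D_(delta_mx i 0) f x.
Proof.
move=> df; rewrite {1}(col_sum_delta v) derive_dir_sum //.
by apply: eq_bigr => i _; rewrite derive_dirZ.
Qed.

(** Near [x], [vf_act B f] is a finite sum of the components of [B] times the partial derivatives of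
    [f]. The product rule separates the derivative of [B] from a second derivative of [f] with the
    direction frozen at [B x]. *)
Lemma derive_vf_act (U : set 'cV[R]_n) (f : 'cV[R]_n -> W)
    (B : 'cV[R]_n -> 'cV[R]_n) (x a : 'cV[R]_n) :
  open U -> U x -> differentiable2_on U f -> differentiable B x ->
  differentiable (vf_act B f) x /\
  'D_a (vf_act B f) x = 'D_('D_a B x) f x + 'D_a ('D_(B x) f) x.
Proof.
move=> oU Ux [df d2f] dB.
have nearU : \forall y \near x, U y by exact: open_nbhs_nbhs.
have E : {near x, (fun y => \sum_i B y i 0 *: 'D_(delta_mx i 0) f y) =1
                  vf_act B f}.
  near=> y; rewrite /vf_act [RHS]derive_dir_coord //; apply: df.
  by near: y.
have E' : {near x, (fun y => \sum_i B x i 0 *: 'D_(delta_mx i 0) f y) =1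
                   'D_(B x) f}.
  near=> y; rewrite [RHS]derive_dir_coord //; apply: df.
  by near: y.
have dBi i := (differentiable_mxP B x).1 dB i 0.
have dfi i := d2f (delta_mx i 0) x Ux.
have dZ i := derive_scale a (dBi i) (dfi i).
have dZ' i := derive_scale a (differentiable_cst (B x i 0) x) (dfi i).
split.
  apply: near_eq_differentiable E _.
  by apply: differentiable_bigsum => i; have [] := dZ i.
rewrite -(near_eq_derive _ E) -(near_eq_derive _ E').
rewrite !derive_bigsum; [|by move=> i; have [] := dZ' i|by move=> i; have [] := dZ i].
rewrite (derive_dir_coord ('D_a B x) (df x Ux)) -big_split; apply: eq_bigr => i _ /=.
rewrite (dZ i).2 (dZ' i).2 derive_cst scale0r add0r.
by rewrite derive_coord.
Unshelve. all: by end_near. Qed.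

End VectorFields.

Section Jacobian.
Context {R : realType} {n : nat}.
Implicit Types f g : 'cV[R]_n -> 'cV[R]_n.

Definition jac f (q : 'cV[R]_n) : 'M[R]_n :=
  \matrix_(k, i) ('D_(delta_mx i 0) f q) k 0.

Lemma jacE f (q v : 'cV[R]_n) : differentiable f q -> 'D_v f q = jac f q *m v.
Proof.
move=> df; rewrite derive_dir_coord //; apply/colP => k.
by rewrite summxE mxE; apply: eq_bigr => i _; rewrite !mxE mulrC.
Qed.

Lemma differentiable_jac (U : set 'cV[R]_n) f (q : 'cV[R]_n) :
  U q -> differentiable2_on U f -> differentiable (jac f) q.
Proof.
move=> Uq [_ d2f]; apply/differentiable_mxP => k i.
under eq_fun do rewrite mxE.
exact: (differentiable_mxP _ _).1 (d2f (delta_mx i 0) q Uq) k 0.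
Qed.

End Jacobian.

(** All iterated derivatives are again constants. Constant fields later serve as test fields in the
    definition of [nabla]. *)
Lemma smooth_on_cst {R : realType} {V W : normedModType R} (U : set V) (w : W) :
  smooth_on U (cst w : V -> W).
Proof.
move=> s x Ux.
have [c ->] : exists c, foldr (fun v (g : V -> W) => 'D_v g) (cst w) s = cst c.
  elim: s => [|v s [c IH]] /=; first by exists w.
  by exists 0; rewrite IH; apply/funext => y; rewrite derive_cst.
exact: differentiable_cst.
Qed.

(** * The alpha-connection in coordinates *)

Section Expectation.
Context {R : realType} {d : measure_display} {T : measurableType d}.
Context (mu : {measure set T -> \bar R}) {n : nat} (p : 'cV[R]_n -> T -> R).
Context (th : 'cV[R]_n).

(** Existence is kept together with the value, because additivity of the integral is invoked for
    integrable functions. *)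
Definition has_expect (f : T -> R) (e : R) :=
  expect_exists mu p th f /\ expect mu p th f = e.

Lemma has_expectD f g a b :
  has_expect f a -> has_expect g b -> has_expect (fun x => f x + g x) (a + b).
Proof.
move=> [If <-] [Ig <-]; rewrite /has_expect /expect_exists /expect.
have E x : (f x + g x) * p th x = f x * p th x + g x * p th x by rewrite mulrDl.
under eq_fun do rewrite E; split.
  by under eq_fun do rewrite EFinD; exact: integrableD.
by rewrite -RintegralD //; apply: eq_Rintegral => x _; rewrite E.
Qed.

Lemma has_expectZ k f a : has_expect f a -> has_expect (fun x => k * f x) (k * a).
Proof.
move=> [If <-]; rewrite /has_expect /expect_exists /expect.
under eq_fun do rewrite -mulrA; split.
  by under eq_fun do rewrite EFinM; exact: integrableZl.
by rewrite -RintegralZl //; apply: eq_Rintegral => x _; rewrite mulrA.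
Qed.

Lemma has_expect_sum (I : finType) (f : I -> T -> R) (a : I -> R) :
  (forall i, has_expect (f i) (a i)) ->
  has_expect (fun x => \sum_i f i x) (\sum_i a i).
Proof.
move=> H; elim: (index_enum I) => [|i s IH].
  under eq_fun do rewrite big_nil; rewrite big_nil /has_expect /expect_exists /expect.
  under eq_fun do rewrite mul0r; split; first exact: integrable0.
  rewrite (_ : \int[mu]_x _ = \int[mu]_(x in [set: T]) 0 :> R).
    by rewrite /Rintegral integral0.
  by apply: eq_Rintegral => x _; rewrite mul0r.
by under eq_fun do rewrite big_cons; rewrite big_cons; exact: has_expectD.
Qed.

End Expectation.

Section Sums.
Context {R : comRingType} {n : nat}.
Implicit Types a b c s : 'I_n -> R.

(** Here [s] stands for the coordinate scores at a sample point and [a], [b], [c] for the components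
    of three vector fields. *)
Lemma mulr_sum_score3 a b c s :
  (\sum_i a i * s i) * (\sum_j b j * s j) * (\sum_k c k * s k) =
  \sum_k c k * \sum_i a i * \sum_j b j * (s i * s j * s k).
Proof.
rewrite mulr_sumr; apply: eq_bigr => k _; rewrite mulrCA; congr (_ * _).
rewrite !mulr_suml; apply: eq_bigr => i _; rewrite -!mulrA; congr (_ * _).
by rewrite mulr_suml mulr_sumr; apply: eq_bigr => j _; ring.
Qed.

(** Here [H] stands for the second derivatives of the log-likelihood and [e] for the components of
    the derivative of the second field along the first. *)
Lemma mulr_sum_hess e s a b c (H : 'I_n -> 'I_n -> R) :
  (\sum_j e j * s j + \sum_i a i * \sum_j b j * H i j) * (\sum_k c k * s k) =
  \sum_k c k * (\sum_j e j * (s j * s k) +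
    \sum_i a i * \sum_j b j * (H i j * s k)).
Proof.
rewrite mulr_sumr; apply: eq_bigr => k _; rewrite mulrCA; congr (_ * _).
rewrite mulrDl !mulr_suml; congr (_ + _); apply: eq_bigr => i _; rewrite -mulrA //.
by congr (_ * _); rewrite mulr_suml; apply: eq_bigr => j _; rewrite mulrA.
Qed.

End Sums.

Section StatisticalManifold.
Context {R : realType} {d : measure_display} {T : measurableType d}.
Context {mu : {measure set T -> \bar R}} {n : nat}.
Context (S : stat_manifold mu n).
Local Notation p := (density S).
Local Notation l := (loglik p).
Local Notation G := (fisher mu p).

(** Positivity of the density makes [ln] differentiable at its values, and on [dom S] the derivative
    is that of the density divided by the density. *)
Lemma loglik_differentiable2 x : differentiable2_on (dom S) (l ^~ x).
Proof.
have [dp d2p] := smooth_on_differentiable2 (density_smooth (s := S) x).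
have dln th : dom S th -> differentiable (@ln R) (p th x).
  move=> /(density_gt0 x) p0; apply/derivable1_diffP.
  by have [] := is_derive1_ln p0.
split=> [th Uth|v th Uth].
  exact: (differentiable_comp (dp th Uth) (dln th Uth)).
apply: (@near_eq_differentiable _ _ _ (fun t => 'D_v (p ^~ x) t * (p t x)^-1)).
  near=> t; have Ut : dom S t.
    by near: t; apply: open_nbhs_nbhs; split => //; exact: dom_open.
  have p0 := density_gt0 x Ut.
  rewrite (derive_comp (f := p ^~ x) v (dp t Ut) (dln t Ut)).
  (* The direction is written as a multiple of 1, so that the one-variable derivative of [ln] can be
     used. *)
  rewrite -[X in 'D_X (@ln R) _]mulr1 (@derive_dirZ R _ _ (@ln R) (p t x) 1 _ (dln t Ut)).
  by have [_ ->] := is_derive1_ln p0.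
apply: differentiable_mul; first exact: d2p.
apply: (@differentiableV _ _ (p ^~ x)); first exact: dp.
by rewrite gt_eqF // density_gt0.
Unshelve. all: by end_near. Qed.

Lemma stat_act_loglik A th x : dom S th ->
  stat_act A l th x = \sum_i A th i 0 * stat_act (coord_vf i) l th x.
Proof.
move=> Uth; rewrite /stat_act /vf_act derive_dir_coord //.
exact: (loglik_differentiable2 x).1.
Qed.

Lemma derive2_loglik_swap (v w th : 'cV[R]_n) x : dom S th ->
  'D_w ('D_v (l ^~ x)) th = 'D_v ('D_w (l ^~ x)) th.
Proof.
move=> Uth; have [dl d2l] := loglik_differentiable2 x.
exact: derive_swap_real (@dom_open _ _ _ _ _ S) Uth dl (d2l v th Uth) (d2l w th Uth).
Qed.

Lemma stat_act2_loglik A B th x : dom S th -> differentiable B th ->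
  stat_act A (stat_act B l) th x =
  \sum_j ('D_(A th) B th) j 0 * stat_act (coord_vf j) l th x +
  \sum_i A th i 0 * \sum_j B th j 0 *
    stat_act (coord_vf i) (stat_act (coord_vf j) l) th x.
Proof.
move=> Uth dB; have d2l := loglik_differentiable2 x.
have [_ D] := derive_vf_act (A th) (@dom_open _ _ _ _ _ S) Uth d2l dB.
apply: etrans D _; congr (_ + _).
  exact: derive_dir_coord (d2l.1 th Uth).
have D2 a b := derive_dir_coord a (d2l.2 b th Uth).
apply: etrans (D2 _ _) _; apply: eq_bigr => i _.
apply: (congr1 (fun z => A th i 0 * z)).
(* Linearity is at hand in the outer direction. Swapping moves [B th] outside, where it is expanded
   in coordinates, and a second swap restores the order. *)
rewrite (derive2_loglik_swap (B th) (delta_mx i 0) x Uth) D2.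
apply: eq_bigr => j _.
exact: (congr1 (fun z => B th j 0 * z)
  (derive2_loglik_swap (delta_mx i 0) (delta_mx j 0) x Uth)).
Qed.

Lemma fisher_sym th : (G th)^T = G th.
Proof.
apply/matrixP => i j; rewrite !mxE; apply: (congr1 (expect mu p th)).
by apply/funext => x; exact: mulrC.
Qed.

(** A nonzero kernel vector would contradict positive definiteness. *)
Lemma fisher_unit th : dom S th -> G th \in unitmx.
Proof.
move=> Uth; rewrite unitmxE unitfE; apply/det0P => -[v v0 vG].
have v0' : v^T != 0 by rewrite -trmx0 (inj_eq trmx_inj).
by have := fisher_posdef Uth v0'; rewrite trmxK vG mul0mx mxE ltxx.
Qed.

Context (alpha : R).

(** The Christoffel symbols of the first kind of the alpha-connection in the global coordinates. *)
Definition conn_coef (i j k : 'I_n) (th : 'cV[R]_n) : R :=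
  expect mu p th (hess_score p (coord_vf i) (coord_vf j) (coord_vf k) th) +
  (1 - alpha) / 2 *
  expect mu p th (score3 p (coord_vf i) (coord_vf j) (coord_vf k) th).

(** The inverse Fisher matrix raises the index [k]: column [j] holds the components of the covariant
    derivative of [coord_vf j] along [coord_vf i]. *)
Definition conn_comp (i : 'I_n) (th : 'cV[R]_n) : 'M[R]_n :=
  invmx (G th) *m \matrix_(k, j) conn_coef i j k th.

Definition conn (th v : 'cV[R]_n) : 'M[R]_n := \sum_i v i 0 *: conn_comp i th.

(** Second derivatives of the log-likelihood commute, and the cubic term is symmetric. This is the
    source of torsion-freeness. *)
Lemma conn_coef_sym i j k th : dom S th -> conn_coef i j k th = conn_coef j i k th.
Proof.
move=> Uth; rewrite /conn_coef.
have -> : hess_score p (coord_vf i) (coord_vf j) (coord_vf k) th =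
          hess_score p (coord_vf j) (coord_vf i) (coord_vf k) th.
  apply/funext => x; apply: (congr1 (fun z => z * stat_act (coord_vf k) l th x)).
  exact: (derive2_loglik_swap (delta_mx j 0) (delta_mx i 0) x Uth).
have -> // : score3 p (coord_vf i) (coord_vf j) (coord_vf k) th =
          score3 p (coord_vf j) (coord_vf i) (coord_vf k) th.
apply/funext => x.
exact: (congr1 (fun z => z * stat_act (coord_vf k) l th x) (mulrC _ _)).
Qed.

Lemma differentiable_fisher th : dom S th -> differentiable G th.
Proof.
move=> Uth; apply/differentiable_mxP => i j; under eq_fun do rewrite mxE.
by have [_ /(_ [::] th Uth)] := regular_score2 S i j.
Qed.

Lemma differentiable_conn_comp i th : dom S th -> differentiable (conn_comp i) th.
Proof.
move=> Uth; apply: differentiable_mulmx.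
  by apply: differentiable_invmx (fisher_unit Uth); exact: differentiable_fisher.
apply/differentiable_mxP => k j; under eq_fun do rewrite mxE.
have [_ /(_ [::] th Uth) dh] := regular_hess_score S i j k.
have [_ /(_ [::] th Uth) ds] := regular_score3 S i j k.
apply: differentiableD dh _.
by apply: differentiable_mul ds; exact: differentiable_cst.
Qed.

Lemma connB th (v w : 'cV[R]_n) : conn th (v - w) = conn th v - conn th w.
Proof. by rewrite /conn -sumrB; apply: eq_bigr => i _; rewrite !mxE scalerBl. Qed.

Lemma conn_mulmx th a b :
  conn th a *m b =
  invmx (G th) *m \col_k \sum_i a i 0 * \sum_j b j 0 * conn_coef i j k th.
Proof.
rewrite /conn mulmx_suml; under eq_bigr do rewrite -scalemxAl -mulmxA scalemxAr.
rewrite -mulmx_sumr; congr (_ *m _); apply/colP => k; rewrite summxE mxE.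
apply: eq_bigr => i _; rewrite !mxE; congr (_ * _).
by apply: eq_bigr => j _; rewrite mxE mulrC.
Qed.

Lemma conn_sym th a b : dom S th -> conn th a *m b = conn th b *m a.
Proof.
move=> Uth; rewrite !conn_mulmx; congr (_ *m _); apply/colP => k; rewrite !mxE.
under eq_bigr do rewrite mulr_sumr; rewrite exchange_big /=.
apply: eq_bigr => j _; rewrite mulr_sumr; apply: eq_bigr => i _.
by rewrite mulrCA conn_coef_sym.
Qed.

(** The integrand is a finite combination of coordinate integrands, whose expectations exist by
    regularity. The terms that differentiate [B] contribute entries of the Fisher matrix. *)
Lemma has_expect_hess_score A B C th : dom S th -> differentiable B th ->
  has_expect mu p th (hess_score p A B C th)
    (\sum_k C th k 0 * (\sum_j ('D_(A th) B th) j 0 * G th j k +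
     \sum_i A th i 0 * \sum_j B th j 0 *
       expect mu p th (hess_score p (coord_vf i) (coord_vf j) (coord_vf k) th))).
Proof.
move=> Uth dB.
have -> : hess_score p A B C th = fun x =>
  \sum_k C th k 0 * (\sum_j ('D_(A th) B th) j 0 *
      score2 p (coord_vf j) (coord_vf k) th x +
     \sum_i A th i 0 * \sum_j B th j 0 *
       hess_score p (coord_vf i) (coord_vf j) (coord_vf k) th x).
  apply/funext => x; rewrite /hess_score stat_act2_loglik // (stat_act_loglik C) //.
  exact: (mulr_sum_hess _ (fun i => stat_act (coord_vf i) l th x)).
apply: has_expect_sum => k; apply: has_expectZ; apply: has_expectD.
  apply: has_expect_sum => j; apply: has_expectZ; split; last by rewrite mxE.
  by have [/(_ th Uth)] := regular_score2 S j k.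
apply: has_expect_sum => i; apply: has_expectZ.
apply: has_expect_sum => j; apply: has_expectZ; split => //.
by have [/(_ th Uth)] := regular_hess_score S i j k.
Qed.

Lemma has_expect_score3 A B C th : dom S th ->
  has_expect mu p th (score3 p A B C th)
    (\sum_k C th k 0 * \sum_i A th i 0 * \sum_j B th j 0 *
       expect mu p th (score3 p (coord_vf i) (coord_vf j) (coord_vf k) th)).
Proof.
move=> Uth.
have -> : score3 p A B C th = fun x =>
  \sum_k C th k 0 * \sum_i A th i 0 * \sum_j B th j 0 *
       score3 p (coord_vf i) (coord_vf j) (coord_vf k) th x.
  apply/funext => x; rewrite /score3 !(stat_act_loglik _ _ Uth).
  exact: (mulr_sum_score3 _ _ _ (fun i => stat_act (coord_vf i) l th x)).
apply: has_expect_sum => k; apply: has_expectZ.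
apply: has_expect_sum => i; apply: has_expectZ.
apply: has_expect_sum => j; apply: has_expectZ; split => //.
by have [/(_ th Uth)] := regular_score3 S i j k.
Qed.

(** The candidate [w0] satisfies the defining relation for every test field by expansion in
    coordinates, and nondegeneracy of the metric makes it the only solution. *)
Lemma nablaE A B th : dom S th -> differentiable B th ->
  nabla S alpha A B th = 'D_(A th) B th + conn th (A th) *m B th.
Proof.
move=> Uth dB; set w0 := _ + _.
have P0 C : fisher_metric S th w0 (C th) =
    expect mu p th (hess_score p A B C th) +
    (1 - alpha) / 2 * expect mu p th (score3 p A B C th).
  have [_ ->] := has_expect_hess_score A C Uth dB.
  have [_ ->] := has_expect_score3 A B C Uth.
  rewrite mulr_sumr -big_split /=.
  have -> : fisher_metric S th w0 (C th) =
     \sum_k C th k 0 * (('D_(A th) B th)^T *m G th +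
       (\col_k \sum_i A th i 0 * \sum_j B th j 0 * conn_coef i j k th)^T) 0 k.
    (* The Fisher matrix of the metric cancels its inverse in [conn]. *)
    rewrite /fisher_metric /w0 conn_mulmx linearD /= trmx_mul trmx_inv fisher_sym.
    rewrite mulmxDl mulmxKV ?fisher_unit // mxE.
    by apply: eq_bigr => k _; rewrite mulrC.
  apply: eq_bigr => k _; rewrite mulrCA -mulrDr -addrA !mxE; congr (_ * (_ + _)).
    by apply: eq_bigr => j _; rewrite !mxE.
  rewrite mulr_sumr -big_split /=; apply: eq_bigr => i _.
  rewrite mulrCA -mulrDr; apply: (congr1 ( *%R (A th i 0))).
  rewrite mulr_sumr -big_split /=; apply: eq_bigr => j _.
  by rewrite /conn_coef mulrDr [X in _ + X = _]mulrCA.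
apply: get_unique => [C _|w Hw]; first exact: P0.
(* For uniqueness, the constant field [w - w0] is the test field: its squared length would be both
   zero and positive. *)
apply/eqP; rewrite -subr_eq0; apply/negPn/negP => v0.
have trB : (w - w0)^T = w^T - w0^T by rewrite linearB.
have := fisher_posdef Uth v0; rewrite trB !mulmxBl mxE [X in _ + X]mxE.
have := Hw (cst (w - w0)) (@smooth_on_cst _ _ _ _ _); rewrite -P0 /fisher_metric /= => ->.
by rewrite subrr ltxx.
Qed.

End StatisticalManifold.

(** * The identity chart and the gauge identity *)

Lemma smooth_on_id {R : realType} {V : normedModType R} (U : set V) :
  smooth_on U (id : V -> V).
Proof.
move=> s x Ux.
have : foldr (fun v (g : V -> V) => 'D_v g) id s = id \/
    exists c, foldr (fun v (g : V -> V) => 'D_v g) id s = cst c.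
  elim: s => [|v s [IH|[c IH]]] /=; first by left.
    by right; exists v; rewrite IH; apply/funext => y; rewrite derive_id.
  by right; exists 0; rewrite IH; apply/funext => y; rewrite derive_cst.
by case=> [->|[c ->]]; [exact: ex_diff|exact: differentiable_cst].
Qed.

Lemma eq_mulmx_col {R : comRingType} {m n : nat} (A B : 'M[R]_(m, n)) :
  (forall i, A *m delta_mx i 0 = B *m delta_mx i (0 : 'I_1)) -> A = B.
Proof.
move=> AB; apply/matrixP => k i; have := AB i; rewrite -!colE => /colP/(_ k).
by rewrite !mxE.
Qed.

(** In the application [P] is the chart frame, [J] its inverse, [a] the frame matrix and [a'] its
    inverse. The second hypothesis is the differentiated relation [P *m J = 1%:M]; it cancels the
    inhomogeneous terms. *)
Lemma connection_form_gauge {R : comRingType} {n : nat}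
    (a' a P J dP dJ c w : 'M[R]_n) :
  P *m J = 1%:M -> P *m dJ = - (dP *m J) ->
  a' *m P *m (J *m (dP + c *m P)) *m (J *m a) +
    a' *m P *m (dJ *m a + J *m w) = a' *m (c *m a + w).
Proof.
move=> PJ PdJ; rewrite -!mulmxA -mulmxDr; congr (_ *m _).
rewrite (mulmxA P J) PJ mul1mx mulmxDl (mulmxDr P) !mulmxA PdJ PJ mul1mx.
rewrite -(mulmxA c P J) PJ mulmx1 mulNmx.
by rewrite addrACA subrr add0r.
Qed.

Section IdentityChart.
Context {R : realType} {n : nat} {M : set 'cV[R]_n} (oM : open M).

Let open_img : open (id @` M). Proof. by rewrite image_id. Qed.

(** Supplies a chart around every point, so that the condition over all charts in [omega] determines
    a value. *)
Definition id_chart : chart M :=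
  @Chart _ _ M M id id oM (fun _ => id) open_img (fun _ _ => erefl)
    (@smooth_on_id _ _ M) (@smooth_on_id _ _ (id @` M)).

End IdentityChart.

(** * Charts *)

Section ChartCalculus.
Context {R : realType} {n : nat} {M : set 'cV[R]_n} (b : chart M).
Local Notation J := (jac (cmap b)).
Local Notation P := (chart_frame b).

Lemma cmap_differentiable2 : differentiable2_on (cdom b) (cmap b).
Proof. by apply: smooth_on_differentiable2; exact: cmap_smooth. Qed.

Lemma cinv_differentiable2 : differentiable2_on (cmap b @` cdom b) (cinv b).
Proof. by apply: smooth_on_differentiable2; exact: cinv_smooth. Qed.

Lemma near_cdom q : cdom b q -> \forall y \near q, cdom b y.
Proof. by move=> bq; apply: open_nbhs_nbhs; split => //; exact: cdom_open. Qed.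

Lemma chart_vfE i q : chart_vf b i q = P q *m delta_mx i 0.
Proof. by rewrite -colE; apply/colP => k; rewrite !mxE. Qed.

(** The chain rule for [cinv b] after [cmap b], which is the identity near [q]. *)
Lemma chart_frame_jac q : cdom b q -> P q *m J q = 1%:M.
Proof.
move=> bq; apply: eq_mulmx_col => i.
have dm := cmap_differentiable2.1 q bq.
have di := cinv_differentiable2.1 (cmap b q) (imageP _ bq).
rewrite mul1mx -mulmxA -(jacE _ dm) -[P q]/(jac (cinv b) (cmap b q)) -(jacE _ di).
rewrite -(derive_comp _ dm di) -[RHS](derive_id q); apply: near_eq_derive.
by near=> y; apply: cmapK; near: y; exact: near_cdom.
Unshelve. all: by end_near. Qed.

Lemma jac_chart_frame q : cdom b q -> J q *m P q = 1%:M.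
Proof. by move=> /chart_frame_jac/mulmx1C. Qed.

Lemma invmx_chart_frame q : cdom b q -> invmx (P q) = J q.
Proof.
move=> bq; have PJ := chart_frame_jac bq.
have [Pu _] := mulmx1_unit PJ.
by rewrite -[LHS]mulmx1 -PJ mulKmx.
Qed.

Lemma differentiable_chart_vf i q : cdom b q -> differentiable (chart_vf b i) q.
Proof.
move=> bq; exact: (differentiable_comp (cmap_differentiable2.1 q bq)
  (cinv_differentiable2.2 (delta_mx i 0) _ (imageP _ bq))).
Qed.

Lemma differentiable_chart_frame q : cdom b q -> differentiable P q.
Proof.
move=> bq; apply/differentiable_mxP => k i; under eq_fun do rewrite mxE.
exact: (differentiable_mxP _ _).1 (differentiable_chart_vf i bq) k 0.
Qed.

Lemma derive_chart_frame q v i : cdom b q ->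
  'D_v P q *m delta_mx i 0 = 'D_v (chart_vf b i) q.
Proof.
move=> bq.
have := derive_mulmx v (differentiable_chart_frame bq)
  (differentiable_cst (delta_mx i 0 : 'cV[R]_n) q).
rewrite derive_cst mulmx0 addr0 => <-.
by congr ('D_v _ q); apply/funext => y; rewrite chart_vfE.
Qed.

Lemma derive_chart_vf q v i : cdom b q ->
  'D_v (chart_vf b i) q = 'D_('D_v (cmap b) q) ('D_(delta_mx i 0) (cinv b)) (cmap b q).
Proof.
move=> bq.
exact: (derive_comp v (cmap_differentiable2.1 q bq)
  (cinv_differentiable2.2 (delta_mx i 0) _ (imageP _ bq))).
Qed.

Lemma derive_cmap_chart_vf q i : cdom b q ->
  'D_(chart_vf b i q) (cmap b) q = delta_mx i 0.
Proof.
move=> bq; rewrite (jacE _ (cmap_differentiable2.1 q bq)) chart_vfE mulmxA.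
by rewrite jac_chart_frame // mul1mx.
Qed.

(** Coordinate fields commute: both sides are mixed second derivatives of [cinv b] at [cmap b q]. *)
Lemma derive_chart_vf_swap q i j : cdom b q ->
  'D_(chart_vf b j q) (chart_vf b i) q = 'D_(chart_vf b i q) (chart_vf b j) q.
Proof.
move=> bq.
have E k m : 'D_(chart_vf b k q) (chart_vf b m) q =
    'D_(delta_mx k 0) ('D_(delta_mx m 0) (cinv b)) (cmap b q).
  apply: etrans (derive_chart_vf _ _ bq) _.
  by rewrite (derive_cmap_chart_vf k bq).
have sw := derive_swap (delta_mx i 0) (delta_mx j 0) (@cimg_open _ _ _ b)
  (imageP _ bq) cinv_differentiable2.
exact (etrans (E j i) (etrans sw (esym (E i j)))).
Qed.

Lemma chart_vf_decomp q v : cdom b q ->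
  v = \sum_i ('D_v (cmap b) q) i 0 *: chart_vf b i q.
Proof.
move=> bq; rewrite -[LHS]mul1mx -(chart_frame_jac bq) -mulmxA.
rewrite -(jacE _ (cmap_differentiable2.1 q bq)) {1}(col_sum_delta ('D_v _ _)).
rewrite mulmx_sumr; apply: eq_bigr => i _.
by rewrite -scalemxAr chart_vfE.
Qed.

End ChartCalculus.

(** * The connection form *)

Section ConnectionForm.
Context {R : realType} {d : measure_display} {T : measurableType d}.
Context {mu : {measure set T -> \bar R}} {n : nat}.
Context (S : stat_manifold mu n) (alpha : R).
Local Notation conn := (conn S alpha).

(** This is the gauge transform of [conn] by the chart frame, checked column by column. *)
Lemma omega_baseE (b : chart (dom S)) q v : cdom b q ->
  omega_base alpha b q v =
  jac (cmap b) q *m ('D_v (chart_frame b) q + conn q v *m chart_frame b q).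
Proof.
move=> bq; have Sq : dom S q := cdom_sub bq.
apply: eq_mulmx_col => j.
have dj := differentiable_chart_vf j bq.
have -> : omega_base alpha b q v *m delta_mx j 0 =
    \sum_i ('D_v (cmap b) q) i 0 *: christoffel alpha b j i q.
  rewrite -colE; apply/colP => k; rewrite !mxE summxE.
  by apply: eq_bigr => i _; rewrite [RHS]mxE mulrC.
(* The coefficient differentiates field [i] along field [j]; commutation of coordinate fields turns
   this into the derivative of column [j] of the frame along field [i]. *)
have chE i : christoffel alpha b j i q = jac (cmap b) q *m
    ('D_(chart_vf b i q) (chart_vf b j) q + conn q (chart_vf b j q) *m chart_vf b i q).
  rewrite /christoffel invmx_chart_frame //; apply: congr1.
  apply: etrans (nablaE _ _ Sq (differentiable_chart_vf i bq)) _.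
  exact (congr1 (fun z => z + conn q (chart_vf b j q) *m chart_vf b i q)
    (derive_chart_vf_swap i j bq)).
(* Symmetry of [conn] makes the same exchange in the zeroth-order term. *)
have RE : ('D_v (chart_frame b) q + conn q v *m chart_frame b q) *m delta_mx j 0 =
    'D_v (chart_vf b j) q + conn q (chart_vf b j q) *m v.
  apply: etrans (mulmxDl _ _ _) _; apply: congr2.
    exact: derive_chart_frame.
  apply: etrans (esym (mulmxA _ _ _)) _.
  apply: etrans (congr1 (mulmx (conn q v)) (esym (chart_vfE b j q))) _.
  exact: conn_sym.
apply: esym; apply: etrans (esym (mulmxA _ _ _)) _.
apply: etrans (congr1 (mulmx (jac (cmap b) q)) RE) _.
have -> : 'D_v (chart_vf b j) q =
    \sum_i ('D_v (cmap b) q) i 0 *: 'D_(chart_vf b i q) (chart_vf b j) q.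
  rewrite {1}(chart_vf_decomp v bq); apply: etrans (derive_dir_sum _ dj) _.
  by apply: eq_bigr => i _; exact: derive_dirZ.
have -> : conn q (chart_vf b j q) *m v =
    \sum_i ('D_v (cmap b) q) i 0 *: (conn q (chart_vf b j q) *m chart_vf b i q).
  rewrite {1}(chart_vf_decomp v bq) mulmx_sumr.
  by apply: eq_bigr => i _; rewrite scalemxAr.
rewrite -big_split mulmx_sumr; apply: eq_bigr => i _ /=.
by rewrite chE -scalerDr scalemxAr.
Qed.

Lemma derive_trivialization (b : chart (dom S)) (u V : frame_space R n) :
  cdom b u.1 ->
  'D_V (trivialization b) u =
  'D_V.1 (jac (cmap b)) u.1 *m u.2 + jac (cmap b) u.1 *m V.2.
Proof.
move=> bu.
have dJ : differentiable (jac (cmap b)) u.1.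
  exact: differentiable_jac bu (cmap_differentiable2 b).
have dJ1 : differentiable (fun w : frame_space R n => jac (cmap b) w.1) u.
  exact: (differentiable_comp (differentiable_fst u) dJ).
have nb : \forall w \near u, cdom b w.1.
  exact: (@cvg_fst _ _ (nbhs u.1) (nbhs u.2)) (near_cdom bu).
transitivity ('D_V (fun w : frame_space R n => jac (cmap b) w.1 *m w.2) u).
  apply: near_eq_derive; near=> w; rewrite /trivialization invmx_chart_frame //.
  by near: w.
rewrite (derive_mulmx V dJ1 (differentiable_snd u)) derive_snd.
by rewrite (derive_comp V (differentiable_fst u) dJ) derive_fst.
Unshelve. all: by end_near. Qed.

(** The right side does not mention the chart, which is the agreement of the local forms on
    overlaps. *)
Lemma omega_localE (b : chart (dom S)) (u V : frame_space R n) :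
  FS S u -> cdom b u.1 ->
  omega_local alpha b u V = invmx u.2 *m (conn u.1 V.1 *m u.2 + V.2).
Proof.
move=> [_ uu] bu.
have PJ := chart_frame_jac bu; have JP := jac_chart_frame bu.
have phiE : trivialization b u = jac (cmap b) u.1 *m u.2.
  by rewrite /trivialization invmx_chart_frame.
have JPu := mulmx1_unit PJ.
have phiV : invmx (trivialization b u) = invmx u.2 *m chart_frame b u.1.
  have E : trivialization b u *m (invmx u.2 *m chart_frame b u.1) = 1%:M.
    by rewrite phiE -mulmxA mulKVmx.
  have [Tu _] := mulmx1_unit E.
  by rewrite -[LHS]mulmx1 -E mulKmx.
(* Differentiating [P *m J = 1%:M] near [u.1]. *)
have DPJ : chart_frame b u.1 *m 'D_V.1 (jac (cmap b)) u.1 =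
           - ('D_V.1 (chart_frame b) u.1 *m jac (cmap b) u.1).
  have : 'D_V.1 (fun y => chart_frame b y *m jac (cmap b) y) u.1 = 0.
    rewrite -[RHS](derive_cst (1%:M : 'M[R]_n) u.1 V.1); apply: near_eq_derive.
    near=> y; rewrite chart_frame_jac //; near: y; exact: near_cdom.
  rewrite derive_mulmx; first by move=> /eqP; rewrite addrC addr_eq0 => /eqP.
    exact: differentiable_chart_frame.
  exact: differentiable_jac bu (cmap_differentiable2 b).
rewrite /omega_local /Ad /maurer_cartan invmxK derive_trivialization //.
rewrite /fb_pi /fb_dpi omega_baseE // phiV phiE.
exact: connection_form_gauge PJ DPJ.
Unshelve. all: by end_near. Qed.

End ConnectionForm.

(** * Matrix identities for the curvature *)

(** Here [z] is the value of the field [Z], [zX] and [zY] are its derivatives along [X] and [Y], [s]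
    is the common mixed second derivative, and [t1], [t2] are its derivatives along the two halves
    of the bracket. *)
Lemma curvature_algebra {R : comRingType} {n : nat} (cX cY cL dXY dYX : 'M[R]_n)
    (z zX zY s t1 t2 : 'cV[R]_n) :
  (t1 + s + (dXY *m z + cY *m zX)) + cX *m (zY + cY *m z) -
  ((t2 + s + (dYX *m z + cX *m zY)) + cY *m (zX + cX *m z)) -
  ((t1 - t2) + cL *m z) =
  (dXY - dYX + cX *m cY - cY *m cX - cL) *m z.
Proof.
rewrite !mulmxDl !mulNmx !mulmxDr -!mulmxA; apply/colP => k.
move: (dXY *m z) (dYX *m z) (cX *m zY) (cY *m zX) (cX *m _) (cY *m _) (cL *m z).
by move=> *; rewrite !mxE; ring.
Qed.

(** The left side is minus the connection form on the bracket of two lifts; the right side is the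
    curvature matrix conjugated by the frame [a]. *)
Lemma bracket_algebra {R : comUnitRingType} {n : nat} (a cX cY cL dXY dYX : 'M[R]_n) :
  a \in unitmx ->
  - (invmx a *m (cL *m a + (- (dXY *m a + cY *m - (cX *m a)) -
     - (dYX *m a + cX *m - (cY *m a))))) =
  invmx a *m (dXY - dYX + cX *m cY - cY *m cX - cL) *m a.
Proof.
move=> ua; rewrite -mulmxN -mulmxA; congr (_ *m _).
rewrite !mulmxDl !mulNmx !mulmxN !mulmxA; apply/matrixP => i j.
move: (dXY *m a) (dYX *m a) (cX *m cY *m a) (cY *m cX *m a) (cL *m a).
by move=> *; rewrite !mxE; ring.
Qed.

Lemma bracket_cancel {R : comRingType} {n : nat} (c1 c2 d1 d2 m1 m2 : 'M[R]_n) :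
  (c1 + d1) - (c2 + d2) + m1 - m2 - (c1 - c2) = d1 - d2 + m1 - m2.
Proof. by apply/matrixP => i j; rewrite !mxE; ring. Qed.

(** * Horizontal lifts, torsion and curvature *)

Section Curvature.
Context {R : realType} {d : measure_display} {T : measurableType d}.
Context {mu : {measure set T -> \bar R}} {n : nat}.
Context (S : stat_manifold mu n) (alpha : R).
Local Notation conn := (conn S alpha).
Local Notation conn_comp := (conn_comp S alpha).
Local Notation nab := (nabla S alpha).
Implicit Types (X Y Z : 'cV[R]_n -> 'cV[R]_n) (u V : frame_space R n).

Lemma near_dom q : dom S q -> \forall y \near q, dom S y.
Proof. by move=> Sq; apply: open_nbhs_nbhs; split => //; exact: dom_open. Qed.

(** F(S) is open, so formulas valid on it can be differentiated at its points. *)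
Lemma near_FS u : FS S u -> \forall w \near u, FS S w.
Proof.
move=> [Su uu]; near=> w; split; near: w.
  exact: (@cvg_fst _ _ (nbhs u.1) (nbhs u.2)) (near_dom Su).
exact: near_unitmx (differentiable_snd u) uu.
Unshelve. all: by end_near. Qed.

(** Every local form takes this value, and the identity chart forces any admissible value to equal
    it. *)
Lemma omegaE u V : FS S u ->
  omega S alpha u V = invmx u.2 *m (conn u.1 V.1 *m u.2 + V.2).
Proof.
move=> Fu; apply: get_unique => [b bu|A HA]; first by rewrite omega_localE.
have bu : cdom (id_chart (@dom_open _ _ _ _ _ S)) u.1 by exact: Fu.1.
by rewrite (HA _ bu) omega_localE.
Qed.

Lemma horizontalE u V : FS S u ->
  horizontal S alpha u V <-> V.2 = - (conn u.1 V.1 *m u.2).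
Proof.
move=> Fu; rewrite /horizontal /= omegaE //; split=> [/(congr1 (mulmx u.2))|->].
  by rewrite mulmx0 mulKVmx ?(Fu.2) // => /eqP; rewrite addrC addr_eq0 => /eqP.
by rewrite subrr mulmx0.
Qed.

Definition hlift_field X u : frame_space R n := (X u.1, - (conn u.1 (X u.1) *m u.2)).

Lemma hliftE X u : FS S u -> hlift S alpha X u = hlift_field X u.
Proof.
move=> Fu; apply: get_unique => [|[x w] [/(horizontalE _ Fu) /= -> ->]] //.
by split => //; apply/(horizontalE _ Fu).
Qed.

Lemma hproj_hliftE X u : FS S u -> hproj S alpha u (hlift S alpha X u) = hlift_field X u.
Proof.
move=> Fu; rewrite hliftE //; apply: get_unique => [|[x w]].
  by split; [exact/(horizontalE _ Fu)|rewrite subrr].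
move=> [/(horizontalE _ Fu) /= -> /eqP].
by rewrite /fb_dpi /= subr_eq0 => /eqP <-.
Qed.

(** The derivative along [v] of the coefficients of [conn], with the argument [w] held fixed. *)
Definition dconn (q v w : 'cV[R]_n) : 'M[R]_n := \sum_i w i 0 *: 'D_v (conn_comp i) q.

Lemma derive_conn X q v : dom S q -> differentiable X q ->
  differentiable (fun y => conn y (X y)) q /\
  'D_v (fun y => conn y (X y)) q = conn q ('D_v X q) + dconn q v (X q).
Proof.
move=> Sq dX; have dXi i := (differentiable_mxP X q).1 dX i 0.
have dZ i := derive_scale v (dXi i) (differentiable_conn_comp alpha i Sq).
split; first by apply: differentiable_bigsum => i; exact: (dZ i).1.
apply: etrans (derive_bigsum _ (fun i => (dZ i).1)) _.
rewrite /dconn -big_split; apply: eq_bigr => i _ /=.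
by rewrite (dZ i).2 derive_coord.
Qed.

Lemma derive_hlift_field X u V : FS S u -> differentiable X u.1 ->
  differentiable (hlift_field X) u /\
  'D_V (hlift_field X) u =
  ('D_V.1 X u.1, - ('D_V.1 (fun y => conn y (X y)) u.1 *m u.2 +
                    conn u.1 (X u.1) *m V.2)).
Proof.
move=> Fu dX; have [dc _] := derive_conn V.1 Fu.1 dX.
have df := differentiable_fst u; have ds := differentiable_snd u.
have dX1 := differentiable_comp df dX; have dc1 := differentiable_comp df dc.
have dm := differentiable_mulmx dc1 ds; have dN := differentiableN dm.
split; first exact: differentiable_pair dX1 dN.
apply: etrans (derive_pair V dX1 dN) _; apply: congr2.
  apply: etrans (derive_comp V df dX) _.
  by rewrite derive_fst.
apply: etrans (deriveN (diff_derivable dm)) _; apply: congr1.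
apply: etrans (derive_mulmx V dc1 ds) _; apply: congr2.
  apply: (congr1 (fun z => z *m u.2)); apply: etrans (derive_comp V df dc) _.
  by rewrite derive_fst.
by rewrite derive_snd.
Qed.

(** On the lift of [Y] the canonical form at a frame [a] is the inverse of [a] applied to [Y].
    Agreement of [Yt] with the explicit lift near [u] is assumed so that both [hlift] and its
    horizontal projection are covered. *)
Lemma derive_canonical_hlift Y u V (Yt : frame_space R n -> frame_space R n) :
  FS S u -> differentiable Y u.1 -> {near u, Yt =1 hlift_field Y} ->
  frame_map u ('D_V (fun w => canonical_form w (Yt w)) u) =
  'D_V.1 Y u.1 - V.2 *m invmx u.2 *m Y u.1.
Proof.
move=> Fu dY nY.
have df := differentiable_fst u; have ds := differentiable_snd u.
have dY1 := differentiable_comp df dY.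
have dV := differentiable_invmx ds Fu.2.
have -> : 'D_V (fun w => canonical_form w (Yt w)) u =
    'D_V (fun w : frame_space R n => invmx w.2 *m Y w.1) u.
  apply: near_eq_derive; near=> w.
  have -> : Yt w = hlift_field Y w by near: w.
  by [].
rewrite (derive_mulmx V dV dY1) (derive_invmx V ds Fu.2) derive_snd.
rewrite (derive_comp V df dY) derive_fst /frame_map mulmxDr mulKVmx ?(Fu.2) //.
by rewrite mulNmx mulmxN -!mulmxA mulKVmx ?(Fu.2) // addrC.
Unshelve. all: by end_near. Qed.

Lemma near_hlift X u : FS S u -> {near u, hlift S alpha X =1 hlift_field X}.
Proof. by move=> Fu; near=> w; apply: hliftE; near: w; exact: near_FS.
Unshelve. all: by end_near. Qed.

Lemma near_hproj_hlift X u : FS S u ->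
  {near u, (fun w => hproj S alpha w (hlift S alpha X w)) =1 hlift_field X}.
Proof. by move=> Fu; near=> w; apply: hproj_hliftE; near: w; exact: near_FS.
Unshelve. all: by end_near. Qed.

(** The lifts project to [X] and [Y], so their bracket projects to the bracket on S; the vertical
    part is left unsimplified for [bracket_algebra]. *)
Lemma lie_bracket_hlift X Y u :
  FS S u -> differentiable X u.1 -> differentiable Y u.1 ->
  lie_bracket (fun w => hproj S alpha w (hlift S alpha X w))
              (fun w => hproj S alpha w (hlift S alpha Y w)) u =
  (lie_bracket X Y u.1,
   - ('D_(X u.1) (fun y => conn y (Y y)) u.1 *m u.2 +
      conn u.1 (Y u.1) *m - (conn u.1 (X u.1) *m u.2)) -
   - ('D_(Y u.1) (fun y => conn y (X y)) u.1 *m u.2 +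
      conn u.1 (X u.1) *m - (conn u.1 (Y u.1) *m u.2))).
Proof.
move=> Fu dX dY; rewrite /lie_bracket /vf_act !hproj_hliftE //.
rewrite (near_eq_derive (hlift_field X u) (near_hproj_hlift Y Fu)).
rewrite (near_eq_derive (hlift_field Y u) (near_hproj_hlift X Fu)).
by rewrite (derive_hlift_field _ Fu dX).2 (derive_hlift_field _ Fu dY).2.
Qed.

Lemma nabla_torsion_free X Y q :
  dom S q -> differentiable X q -> differentiable Y q ->
  nab X Y q - nab Y X q - lie_bracket X Y q = 0.
Proof.
move=> Sq dX dY; rewrite (nablaE _ _ Sq dX) (nablaE _ _ Sq dY) (conn_sym _ _ _ Sq).
by rewrite opprD addrACA subrr addr0 subrr.
Qed.

(** The two derivative terms of the exterior derivative become covariant derivatives, and the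
    canonical form of the bracket of the lifts becomes the bracket on S. *)
Lemma torsion_formE X Y u :
  FS S u -> differentiable X u.1 -> differentiable Y u.1 ->
  frame_map u (torsion_form S alpha (hlift S alpha X) (hlift S alpha Y) u) =
  nab X Y u.1 - nab Y X u.1 - lie_bracket X Y u.1.
Proof.
move=> Fu dX dY; rewrite /torsion_form /dform_h /dform.
have frameB v w : frame_map u (v - w) = frame_map u v - frame_map u w.
  exact: mulmxBr.
rewrite !frameB lie_bracket_hlift //; apply: congr2; last first.
  by rewrite /frame_map /canonical_form /frame_inv /fb_dpi /= mulKVmx ?(Fu.2).
have E Z W : differentiable W u.1 ->
    frame_map u (vf_act (fun w => hproj S alpha w (hlift S alpha Z w))
      (fun y => canonical_form y (hproj S alpha y (hlift S alpha W y))) u) =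
    nab Z W u.1.
  move=> dW; rewrite /vf_act hproj_hliftE //.
  apply: etrans (derive_canonical_hlift _ Fu dW (near_hproj_hlift W Fu)) _.
  (* The matrix part of the lift carries a minus sign, which cancels the one from differentiating
     the inverse frame. *)
  rewrite (nablaE _ _ Fu.1 dW) /hlift_field [(_, _).1]/= [(_, _).2]/=.
  by rewrite !mulNmx opprK mulmxK ?(Fu.2).
exact (congr2 (fun a b => a - b) (E X Y dY) (E Y X dX)).
Qed.

(** Cartan's expression [dC + C /\ C] for the connection matrix, evaluated on [X] and [Y]. *)
Definition curvature_mx X Y (q : 'cV[R]_n) : 'M[R]_n :=
  'D_(X q) (fun y => conn y (Y y)) q - 'D_(Y q) (fun y => conn y (X y)) q
  + conn q (X q) *m conn q (Y q) - conn q (Y q) *m conn q (X q)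
  - conn q (lie_bracket X Y q).

(** The connection form vanishes on lifts throughout a neighbourhood of [u], so only the bracket
    term of the exterior derivative remains. *)
Lemma curvature_formE X Y u (z : 'cV[R]_n) :
  FS S u -> differentiable X u.1 -> differentiable Y u.1 ->
  frame_map u (curvature_form S alpha (hlift S alpha X) (hlift S alpha Y) u
               *m frame_inv u z) = curvature_mx X Y u.1 *m z.
Proof.
move=> Fu dX dY; rewrite /curvature_form /dform_h /dform.
have E (V : frame_space R n -> frame_space R n) W : vf_act V
    (fun y : frame_space R n => omega S alpha y (hproj S alpha y (hlift S alpha W y))) u = 0.
  rewrite /vf_act -[RHS](derive_cst (0 : 'M[R]_n) u (V u)).
  apply: near_eq_derive; near=> w.
  have Fw : FS S w by near: w; exact: near_FS.
  by rewrite hproj_hliftE // omegaE //= subrr mulmx0.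
rewrite !E subrr sub0r lie_bracket_hlift // omegaE //= bracket_algebra ?(Fu.2) //.
rewrite /frame_map /frame_inv -!mulmxA mulKVmx ?(Fu.2) // mulKVmx ?(Fu.2) //.
Unshelve. all: by end_near. Qed.

(* Tensoriality: the derivatives of [X] and [Y] cancel against the bracket term. *)
Lemma curvature_mxE X Y q : dom S q -> differentiable X q -> differentiable Y q ->
  curvature_mx X Y q = dconn q (X q) (Y q) - dconn q (Y q) (X q)
  + conn q (X q) *m conn q (Y q) - conn q (Y q) *m conn q (X q).
Proof.
move=> Sq dX dY; rewrite /curvature_mx (derive_conn _ Sq dX).2 (derive_conn _ Sq dY).2.
rewrite /lie_bracket connB; exact: bracket_cancel.
Qed.

Lemma derive_nabla Y Z q v : dom S q -> differentiable Y q -> smooth_on (dom S) Z ->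
  differentiable (nab Y Z) q /\
  'D_v (nab Y Z) q = 'D_('D_v Y q) Z q + 'D_v ('D_(Y q) Z) q +
    ('D_v (fun y => conn y (Y y)) q *m Z q + conn q (Y q) *m 'D_v Z q).
Proof.
move=> Sq dY /smooth_on_differentiable2 d2Z.
have dZ := d2Z.1 q Sq.
have [dYZ DYZ] := derive_vf_act v (@dom_open _ _ _ _ _ S) Sq d2Z dY.
have [dc _] := derive_conn v Sq dY.
have dcZ := differentiable_mulmx dc dZ.
have nE : {near q, (vf_act Y Z + (fun y => conn y (Y y) *m Z y)) =1 nab Y Z}.
  near=> y; have Sy : dom S y by near: y; exact: near_dom.
  by rewrite (nablaE _ _ Sy (d2Z.1 y Sy)).
split; first exact: near_eq_differentiable nE (differentiableD dYZ dcZ).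
apply: etrans (esym (near_eq_derive v nE)) _.
apply: etrans (deriveD (diff_derivable dYZ) (diff_derivable dcZ)) _.
exact: congr2 DYZ (derive_mulmx v dc dZ).
Unshelve. all: by end_near. Qed.

(** All derivatives of [Z] cancel: the mixed second ones by symmetry, the first-order ones against
    each other and the bracket term. *)
Lemma nabla_commutator X Y Z q : dom S q ->
  smooth_on (dom S) X -> smooth_on (dom S) Y -> smooth_on (dom S) Z ->
  nab X (nab Y Z) q - nab Y (nab X Z) q - nab (lie_bracket X Y) Z q =
  curvature_mx X Y q *m Z q.
Proof.
move=> Sq sX sY sZ.
have d2Z := smooth_on_differentiable2 sZ; have dZ := d2Z.1 q Sq.
have dX := (smooth_on_differentiable2 sX).1 q Sq.
have dY := (smooth_on_differentiable2 sY).1 q Sq.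
have E (A B : 'cV[R]_n -> 'cV[R]_n) : differentiable B q -> nab A (nab B Z) q =
    'D_('D_(A q) B q) Z q + 'D_(A q) ('D_(B q) Z) q +
    ('D_(A q) (fun y => conn y (B y)) q *m Z q + conn q (B q) *m 'D_(A q) Z q) +
    conn q (A q) *m ('D_(B q) Z q + conn q (B q) *m Z q).
  move=> dB; have [dn Dn] := derive_nabla (A q) Sq dB sZ.
  apply: etrans (nablaE _ _ Sq dn) _; apply: congr2 Dn _.
  exact: congr1 (nablaE _ _ Sq dZ).
have EL : nab (lie_bracket X Y) Z q =
    'D_('D_(X q) Y q) Z q - 'D_('D_(Y q) X q) Z q + conn q (lie_bracket X Y q) *m Z q.
  apply: etrans (nablaE _ _ Sq dZ) _; apply: congr2 _ erefl.
  rewrite /lie_bracket -scaleN1r; apply: etrans (derive_dirD _ _ dZ) _.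
  by apply: congr1; apply: etrans (derive_dirZ _ _ dZ) (scaleN1r _).
rewrite (E X Y dY) (E Y X dX) EL.
rewrite (derive_swap (X q) (Y q) (@dom_open _ _ _ _ _ S) Sq d2Z).
exact: curvature_algebra.
Qed.

End Curvature.

Theorem theorem5p8 (R : realType) (d : measure_display) (T : measurableType d)
    (mu : {measure set T -> \bar R}) (n : nat) (S : stat_manifold mu n)
    (alpha : R) (X Y Z : 'cV[R]_n -> 'cV[R]_n)
    (smoothX : smooth_on (dom S) X) (smoothY : smooth_on (dom S) Y)
    (smoothZ : smooth_on (dom S) Z)
    (p : 'cV[R]_n) (u : 'cV[R]_n * 'M[R]_n)
    (pS : dom S p) (uFS : FS S u) (piu : fb_pi u = p) :
  let nab := nabla S alpha in
  let Xt := hlift S alpha X in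
  let Yt := hlift S alpha Y in
  [/\ nab X Y p =
        frame_map u (vf_act Xt (fun w => canonical_form w (Yt w)) u),
      torsion_tensor S alpha p (X p) (Y p) =
        frame_map u (torsion_form S alpha Xt Yt u) /\
      frame_map u (torsion_form S alpha Xt Yt u) =
        nab X Y p - nab Y X p - lie_bracket X Y p
    & curvature_tensor S alpha p (X p) (Y p) (Z p) =
        frame_map u (curvature_form S alpha Xt Yt u *m frame_inv u (Z p)) /\
      frame_map u (curvature_form S alpha Xt Yt u *m frame_inv u (Z p)) =
        nab X (nab Y Z) p - nab Y (nab X Z) p - nab (lie_bracket X Y) Z p].
Proof.
move=> nab Xt Yt; rewrite {}/nab {}/Xt {}/Yt; rewrite /fb_pi in piu; rewrite -{p}piu in pS *.
have smooth_diff (W : 'cV[R]_n -> 'cV[R]_n) : smooth_on (dom S) W -> differentiable W u.1.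
  by move=> /smooth_on_differentiable2 [/(_ _ pS)].
have dX := smooth_diff X smoothX; have dY := smooth_diff Y smoothY.
split.
- apply: esym; rewrite /vf_act hliftE //.
  apply: etrans (derive_canonical_hlift _ uFS dY (near_hlift _ Y uFS)) _.
  rewrite (nablaE _ _ pS dY) /hlift_field [(_, _).1]/= [(_, _).2]/=.
  by rewrite !mulNmx opprK mulmxK ?(uFS.2).
(* Well-definedness of the torsion tensor: for every extension and every frame the candidate value
   is zero. *)
- have tf : frame_map u (torsion_form S alpha (hlift S alpha X) (hlift S alpha Y) u) = 0.
    by rewrite torsion_formE // nabla_torsion_free.
  split; last exact: torsion_formE.
  rewrite tf; apply: get_unique => [X' Y' u' sX' sY' _ _ Fu' u'E|t Ht].
    have S' := Fu'.1; rewrite /fb_pi in u'E.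
    by rewrite torsion_formE ?nabla_torsion_free ?u'E //; exact: smooth_diff.
  by rewrite (Ht X Y u).
- have cf := curvature_formE alpha (Z u.1) uFS dX dY.
  split; last by rewrite cf nabla_commutator.
  (* Existence is tensoriality: the curvature matrix depends on the fields only through their values
     at the point, and the frame drops out. Uniqueness holds because [X], [Y], [u] are themselves
     admissible. *)
  apply: get_unique => [X' Y' u' sX' sY' X'E Y'E Fu' u'E|t Ht]; last exact: Ht.
  rewrite /fb_pi in u'E; have dX' := smooth_diff X' sX'; have dY' := smooth_diff Y' sY'.
  rewrite -u'E in dX' dY'; rewrite cf (curvature_formE alpha _ Fu' dX' dY') u'E.
  rewrite -u'E in pS dX dY X'E Y'E *.
  by rewrite (curvature_mxE alpha pS dX dY) (curvature_mxE alpha pS dX' dY') X'E Y'E.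
Qed.
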